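(* There is an algorithm which, given a graph-like labelled ZX diagram $D$, decides in time polynomial in $|V(D)|$ whether the signature of $D$ admits a PF-Flow, and constructs a PF-Flow if one exists.
   Context: ZX diagrams. A ZX diagram is built from green (Z) spiders and red (X) spiders, each with a phase, together with Hadamard boxes and wires. A labelled ZX diagram gives each node a distinct label and marks each open wire as an input or an output. $V(D)$ denotes its set of spiders. Graph-like. A labelled ZX diagram is graph-like if it has no Hadamard boxes, no wire joins two spiders of the same colour, and there are no parallel wires and no self-loops. Signature. The signature graph $\mathcal G_D$ is the undirected graph obtained from the underlying graph of $D$ in three steps. Add a new vertex at the open end of each input wire; these vertices form $\mathcal I$. Add a new vertex at the open end of each output wire; these form $\mathcal O$. Add a self-loop at each spider whose phase is an odd multiple of $\pi/2$. The set $\mathcal P\subseteq V(D)$ consists of the spiders whose phase is an integer multiple of $\pi/2$. Graph notation. For $C\subseteq V(\mathcal G_D)$, $\mathrm{Odd}(C)$ is the set of vertices adjacent to an odd number of elements of $C$; a vertex with a self-loop counts as its own neighbour. Fix a partial order $\preceq$ on $V(\mathcal G_D)$, and write $a\prec b$ for ($a\preceq b$ and $a\neq b$). For a vertex $u$ with neighbourhood $N(u)$ in $\mathcal G_D$, set $N^+(u)=\{v\in N(u):u\prec v\}$, $N^-(u)=\{v\in N(u):v\prec u\}$ and $\delta^+(u)=|N^+(u)|$. Correctors. A set $C\subseteq V(\mathcal G_D)$ is a $v$-corrector of $u$ if $u\in\mathrm{Odd}(C)$ and $v\prec w$ for every $w\in(C\setminus\mathcal P)\cup(\mathrm{Odd}(C)\setminus\{u\})$.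 PF-Flow. A PF-Flow is a triple $(\preceq,f,\mathfrak C)$: a partial order $\preceq$ on $V(\mathcal G_D)$, a function $f:V(D)\to V(\mathcal G_D)$, and a set $\mathfrak C$ of subsets of $V(\mathcal G_D)$. For every $v\in V(D)$ it must satisfy three conditions. (i) For every $u$ adjacent to $v$ in $\mathcal G_D$: either $u\preceq v$ and $u\notin\mathcal O$, or $v\preceq u$ and $u\notin\mathcal I$ (or both). (ii) If $\delta^+(v)=0$, some $C\in\mathfrak C$ is a $v$-corrector of $v$. (iii) For every $u\in N^-(v)\setminus\{f(v)\}$, some $C\in\mathfrak C$ is a $v$-corrector of $u$.
   Formalization: The time bound is polynomial in |V(D)| plus the number of input and output wires, since one spider may carry arbitrarily many outputs; each real phase is given to the algorithm by whether it is an integer, and whether an odd, multiple of π/2. *)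

(* Defs.v *)
From Stdlib Require Import Reals ZArith ClassicalEpsilon.
From mathcomp Require Import all_boot.


Unset Strict Implicit.
Unset Printing Implicit Defensive.

(* A node is a green (Z) spider, a red (X) spider (each with a real phase),
   or a Hadamard box. *)
Inductive node_kind : Type := NZ of R | NX of R | NH.

(* An end of a wire: attached to node i, or an open end marked as input or
   as output. *)
Inductive endpoint (n : nat) : Type := ESp of 'I_n | EIn | EOut.
Arguments ESp {n} _.
Arguments EIn {n}.
Arguments EOut {n}.

(* Nodes are labelled by 'I_nnodes (distinct labels); wires form a list
   (so parallel wires and self-loops are representable). *)
Record zx : Type := ZX {
  nnodes : nat;
  kind : 'I_nnodes -> node_kind;
  wires : seq (endpoint nnodes * endpoint nnodes)
}.

Definition nwires (D : zx) := size (wires D).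

Definition wend (D : zx) (k : 'I_(nwires D)) (b : bool) : endpoint (nnodes D) :=
  let w := nth (EIn, EIn) (wires D) k in if b then w.2 else w.1.

Definition is_open {n} (e : endpoint n) : bool :=
  match e with ESp _ => false | _ => true end.
Definition is_in {n} (e : endpoint n) : bool :=
  match e with EIn => true | _ => false end.
Definition is_out {n} (e : endpoint n) : bool :=
  match e with EOut => true | _ => false end.
Definition is_node {n} (e : endpoint n) (i : 'I_n) : bool :=
  match e with ESp j => j == i | _ => false end.

Definition is_spider (k : node_kind) : bool :=
  match k with NH => false | _ => true end.
Definition is_green (k : node_kind) : bool :=
  match k with NZ _ => true | _ => false end.
Definition is_red (k : node_kind) : bool :=
  match k with NX _ => true | _ => false end.

Definition spiders (D : zx) : {set 'I_(nnodes D)} :=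
  [set i | is_spider (kind D i)].

Definition graph_like (D : zx) : Prop :=
  [/\ (forall i, kind D i <> NH),
      (forall k i j, is_node (wend D k false) i -> is_node (wend D k true) j ->
          ~ (is_green (kind D i) && is_green (kind D j)) /\
          ~ (is_red (kind D i) && is_red (kind D j))),
      (forall k i, ~ (is_node (wend D k false) i && is_node (wend D k true) i)) &
      (forall k k' i j, k <> k' ->
          (is_node (wend D k false) i && is_node (wend D k true) j
           || is_node (wend D k false) j && is_node (wend D k true) i) ->
          ~ (is_node (wend D k' false) i && is_node (wend D k' true) j
             || is_node (wend D k' false) j && is_node (wend D k' true) i))].

Definition decide (P : Prop) : bool :=
  if excluded_middle_informative P then true else false.

Definition int_mult_half_pi (r : R) : Prop :=
  exists z : Z, r = Rmult (IZR z) (Rdiv PI 2).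
Definition odd_mult_half_pi (r : R) : Prop :=
  exists z : Z, Z.odd z = true /\ r = Rmult (IZR z) (Rdiv PI 2).

Definition phase_in_P (k : node_kind) : bool :=
  match k with NZ r | NX r => decide (int_mult_half_pi r) | NH => false end.
Definition phase_odd (k : node_kind) : bool :=
  match k with NZ r | NX r => decide (odd_mult_half_pi r) | NH => false end.

(* Candidate vertices: the nodes of D, and the ends (k, b) of wires; only
   the open ends are actual vertices (they form I and O). *)
Definition gv (D : zx) : finType :=
  ('I_(nnodes D) + ('I_(nwires D) * bool))%type.

Definition VG (D : zx) : {set gv D} :=
  [set x : gv D | match x with inl _ => true | inr (k, b) => is_open (wend D k b) end].
Definition Iset (D : zx) : {set gv D} :=
  [set x : gv D | match x with inl _ => false | inr (k, b) => is_in (wend D k b) end].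
Definition Oset (D : zx) : {set gv D} :=
  [set x : gv D | match x with inl _ => false | inr (k, b) => is_out (wend D k b) end].
Definition Pset (D : zx) : {set gv D} :=
  [set x : gv D | match x with inl i => phase_in_P (kind D i) | inr _ => false end].

Definition at_end (D : zx) (x : gv D) (k : 'I_(nwires D)) (b : bool) : bool :=
  match x with
  | inl i => is_node (wend D k b) i
  | inr (k', b') => (k' == k) && (b' == b) && is_open (wend D k b)
  end.

Definition sadj (D : zx) (x y : gv D) : bool :=
  [exists k, at_end D x k false && at_end D y k true || at_end D x k true && at_end D y k false]
  || (x == y) && (match x with inl i => phase_odd (kind D i) | inr _ => false end).

Section Flow.
Variable D : zx.
Variable le : rel (gv D).

Definition partial_order_on : Prop :=
  [/\ (forall x y, le x y -> x \in VG D /\ y \in VG D),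
      (forall x, x \in VG D -> le x x),
      (forall x y, le x y -> le y x -> x = y) &
      (forall x y z, le x y -> le y z -> le x z)].

Definition lt (x y : gv D) : bool := le x y && (x != y).

Definition OddS (C : {set gv D}) : {set gv D} :=
  [set v in VG D | odd #|[set c in C | sadj D v c]|].

Definition Nplus (u : gv D) : {set gv D} := [set v in VG D | sadj D u v && lt u v].
Definition Nminus (u : gv D) : {set gv D} := [set v in VG D | sadj D u v && lt v u].

Definition corrector (C : {set gv D}) (v u : gv D) : Prop :=
  u \in OddS C /\
  forall w, w \in (C :\: Pset D) :|: (OddS C :\ u) -> lt v w.

End Flow.

Definition PFflow (D : zx) (le : rel (gv D)) (f : 'I_(nnodes D) -> gv D)
    (CC : {set {set gv D}}) : Prop :=
  [/\ partial_order_on D le,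
      (forall i, i \in spiders D -> f i \in VG D),
      (forall C, C \in CC -> C \subset VG D) &
      forall i, i \in spiders D ->
        let v : gv D := inl i in
        [/\ (forall u, u \in VG D -> sadj D v u ->
               (le u v && (u \notin Oset D)) || (le v u && (u \notin Iset D))),
            (#|Nplus D le v| = 0 -> exists2 C, C \in CC & corrector D le C v v) &
            (forall u, u \in Nminus D le v -> u != f i ->
               exists2 C, C \in CC & corrector D le C v u)]].

Definition has_PFflow (D : zx) : Prop :=
  exists le f CC, PFflow D le f CC.

Inductive move : Type := ML | MR | MS.

Record TM : Type := MkTM {
  tm_n : nat;
  tm_start : 'I_tm_n;
  (* None = halt *)
  tm_delta : 'I_tm_n -> option bool -> option ('I_tm_n * option bool * move)
}.

Record cfg (M : TM) : Type := Cfg {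
  cst : 'I_(tm_n M);
  ctape : nat -> option bool;   (* None = blank *)
  chead : nat
}.

Definition tm_step (M : TM) (c : cfg M) : option (cfg M) :=
  match tm_delta M (cst M c) (ctape M c (chead M c)) with
  | None => None
  | Some (q, s, mv) =>
      Some (Cfg M q (fun p => if p == chead M c then s else ctape M c p)
              (match mv with ML => (chead M c).-1 | MR => (chead M c).+1 | MS => chead M c end))
  end.

Fixpoint tm_run (M : TM) (k : nat) (c : cfg M) : option (cfg M) :=
  match k with
  | 0 => Some c
  | k'.+1 => match tm_step M c with None => None | Some c' => tm_run M k' c' end
  end.

Definition tm_init (M : TM) (w : seq bool) : cfg M :=
  Cfg M (tm_start M) (fun p => nth None (map Some w) p) 0.

Definition cfg_output (M : TM) (c : cfg M) (out : seq bool) : Prop :=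
  (forall i, i < size out -> ctape M c (chead M c + i) = Some (nth false out i)) /\
  ctape M c (chead M c + size out) = None.

Definition halts_within (M : TM) (w : seq bool) (t : nat) (out : seq bool) : Prop :=
  exists k, k <= t /\ exists c, tm_run M k (tm_init M w) = Some c /\
    tm_step M c = None /\ cfg_output M c out.

Definition enc_nat (n : nat) : seq bool := nseq n true ++ [:: false].
Definition enc_nats (l : seq nat) : seq bool := flatten (map enc_nat l).

Definition code_kind (k : node_kind) : nat :=
  match k with NZ _ => 0 | NX _ => 1 | NH => 2 end.

(* The phase of each node is presented through the two bits that the
   signature depends on (phase in P / phase an odd multiple of pi/2). *)
Definition code_node (D : zx) (i : 'I_(nnodes D)) : seq nat :=
  [:: code_kind (kind D i); nat_of_bool (phase_in_P (kind D i));
      nat_of_bool (phase_odd (kind D i))].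

Definition code_ep {n} (e : endpoint n) : nat :=
  match e with ESp i => (nat_of_ord i).+2 | EIn => 0 | EOut => 1 end.

Definition code_zx (D : zx) : seq nat :=
  nnodes D :: flatten [seq code_node D i | i <- enum 'I_(nnodes D)] ++
  nwires D :: flatten [seq [:: code_ep w.1; code_ep w.2] | w <- wires D].

Definition input_word (D : zx) : seq bool := enc_nats (code_zx D).

Definition vidx (D : zx) (x : gv D) : nat :=
  match x with
  | inl i => nat_of_ord i
  | inr (k, b) => nnodes D + (nat_of_ord k).*2 + nat_of_bool b
  end.

Definition encodes_PFflow (D : zx) (out : seq bool) : Prop :=
  exists le f CC, PFflow D le f CC /\
  exists (ps : seq (nat * nat)) (cs : seq (seq nat)),
    out = enc_nats (1 :: size ps :: flatten [seq [:: p.1; p.2] | p <- ps]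
                    ++ [seq vidx D (f i) | i <- enum 'I_(nnodes D)]
                    ++ size cs :: flatten [seq size s :: s | s <- cs]) /\
    (forall x y : gv D, le x y = ((vidx D x, vidx D y) \in ps)) /\
    (forall C : {set gv D},
        C \in CC <-> exists2 s, s \in cs & C = [set x in VG D | vidx D x \in s]).

(* |V(D)| plus the number of open wire ends (= |V(G_D)|) *)
Definition zx_size (D : zx) : nat := #|spiders D| + #|Iset D| + #|Oset D|.

(* Main.v *)
Require Import Defs.
From Stdlib Require Import Reals FunctionalExtensionality.
From mathcomp Require Import all_boot.
From mathcomp Require Import zify.

Set Implicit Arguments.
Unset Strict Implicit.
Unset Printing Implicit Defensive.

(** Whether a vertex [v] may stand immediately below a set [L] of vertices
depends on [L] only, and enlarging [L] preserves every condition of a PF-flow at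
[v], provided that an input enters [L] only after its neighbour. Hence a PF-flow
exists iff every vertex gets added by the greedy process that starts from the
empty set and adds any vertex allowed by the current [L]. A [v]-corrector of [u] is a
solution of a linear system over the two-element field: the unknowns are the
vertices in [L] or [P], with one parity equation per vertex outside [L]. It is
solved by imposing the equations one after the other on a list of generators.

The running time is handled compositionally. A function between encoded data
types is called polynomial when a Turing machine fragment, working on four
stacks stored one after the other on the tape, replaces the code of its argument
on top of the first stack by the code of its value within polynomially many stack
operations and leaves the rest of the stacks unchanged. This class is closed
under composition, pairing, case analysis and folds over lists whose accumulators
have polynomial size, and the greedy algorithm is built from these. *)

(** The order of a flow is unknown, and trying all orders would be exponential. Monotonicity removes
    the choice: if the greedy process gets stuck while a flow exists, take a vertex that is maximal
    in that flow among those left out. Everything above it is already in [L], so its flow conditions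
    make it addable. The map [f] of a flow exempts one lower neighbour per spider; this becomes the
    test that at most one neighbour outside [L] lacks a corrector. All data are coded by binary
    trees in prefix form. Such codes delimit themselves, so copying, exchanging and discarding an
    argument never depends on its type. Iterating a polynomial-time map may square the size in every
    round, hence the explicit bound on the accumulator of a fold. For the elimination it holds
    because the number of generators never grows and each remains a set of vertices. *)

(** * Turing machine fragments and their composition *)

Definition tape := nat -> option bool.
Definition upd (t : tape) (h : nat) (s : option bool) : tape :=
  fun p => if p == h then s else t p.
Definition mvh (mv : move) (h : nat) : nat :=
  match mv with ML => h.-1 | MR => h.+1 | MS => h end.

(* A machine fragment leaves through an exit labelled by an element of [L]. *)
Record frag (L : finType) := Frag {
  fq : finType;
  fstart : fq;
  fdelta : fq -> option bool -> (fq * option bool * move) + L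
}.

(* The step count is an upper bound: [FExit] accepts any [n]. *)
Inductive fruns (L : finType) (M : frag L) :
    fq M -> tape -> nat -> nat -> L -> tape -> nat -> Prop :=
| FExit q t h n l : fdelta q (t h) = inr l -> fruns q t h n l t h
| FStep q t h n l t' h' q' s mv : fdelta q (t h) = inl (q', s, mv) ->
    fruns q' (upd t h s) (mvh mv h) n l t' h' -> fruns q t h n.+1 l t' h'.

Definition runs (L : finType) (M : frag L) := @fruns L M (fstart M).

Lemma fruns_leq (L : finType) (M : frag L) (q : fq M) t h n l t' h' m :
  fruns q t h n l t' h' -> n <= m -> fruns q t h m l t' h'.
Proof.
move=> H; elim: H m => {q t h n l t' h'} [q t h n l E m _|q t h n l t' h' q' s mv E _ IH [|m]] //.
  exact: FExit.
by rewrite ltnS => /IH; apply: FStep E.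
Qed.

Lemma runs_leq (L : finType) (M : frag L) t h n l t' h' m :
  runs M t h n l t' h' -> n <= m -> runs M t h m l t' h'.
Proof. exact: fruns_leq. Qed.

Lemma upd_same (t : tape) h : upd t h (t h) = t.
Proof. by apply: functional_extensionality => p; rewrite /upd; case: eqP => [->|]. Qed.

Definition ret (L : finType) (l : L) : frag L :=
  @Frag L unit tt (fun _ _ => inr l).

Definition act (L : finType) (f : option bool -> option bool * move * L) : frag L :=
  @Frag L (option L : finType) None (fun q y =>
    match q with
    | None => inl (Some (f y).2, (f y).1.1, (f y).1.2)
    | Some l => inr l
    end).

(** Passing from [M] to [k l] takes one step that rewrites the scanned symbol in place; it is the
    extra one in [runs_bind]. *)
Definition bind (L L' : finType) (M : frag L) (k : L -> frag L') : frag L' :=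
  @Frag L' (fq M + {l : L & fq (k l)})%type (inl (fstart M)) (fun q y =>
    match q with
    | inl q => match fdelta q y with
               | inl (q', s, mv) => inl (inl q', s, mv)
               | inr l => inl (inr (existT _ l (fstart (k l))), y, MS)
               end
    | inr (existT l q) => match fdelta q y with
               | inl (q', s, mv) => inl (inr (existT _ l q'), s, mv)
               | inr l' => inr l'
               end
    end).

(** The parameter of the loop is a finite memory carried from one round to the next. The shifts
    below keep in it the symbol displaced by the last write. *)
Definition rep (A B : finType) (a : A) (body : A -> frag (A + B)%type) : frag B :=
  @Frag B {a : A & fq (body a)} (existT _ a (fstart (body a))) (fun q y =>
    match q with
    | existT a q => match fdelta q y with
               | inl (q', s, mv) => inl (existT _ a q', s, mv)
               | inr (inl a') => inl (existT _ a' (fstart (body a')), y, MS)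
               | inr (inr b) => inr b
               end
    end).

Lemma runs_ret (L : finType) (l : L) t h n : runs (ret l) t h n l t h.
Proof. exact: FExit. Qed.

Lemma runs_act (L : finType) (f : option bool -> option bool * move * L) t h n :
  runs (act f) t h n.+1 (f (t h)).2 (upd t h (f (t h)).1.1) (mvh (f (t h)).1.2 h).
Proof. by apply: FStep; [reflexivity | exact: FExit]. Qed.

Lemma runs_bind (L L' : finType) (M : frag L) (k : L -> frag L')
    t h n l t1 h1 n' l' t2 h2 :
  runs M t h n l t1 h1 -> runs (k l) t1 h1 n' l' t2 h2 ->
  runs (bind M k) t h (n + n').+1 l' t2 h2.
Proof.
rewrite /runs /=; move=> H1 H2.
elim: H1 H2 => {t h n l t1 h1} [q t h n l E|q t h n l t' h' q' s mv E _ IH] H2.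
  apply: (FStep (s := t h) (mv := MS) (q' := inr (existT _ l (fstart (k l))) : fq (bind M k))).
    by rewrite /= E.
  rewrite upd_same /=; apply: (@fruns_leq _ _ _ _ _ n'); last exact: leq_addl.
  elim: H2 => {t h n' l' t2 h2 E} [q1 t h n' l' E|q1 t h n' l' t' h' q' s mv E _ IH].
    by apply: FExit; rewrite /= E.
  by apply: FStep IH; rewrite /= E.
rewrite addSn; apply: FStep (IH H2); by rewrite /= E.
Qed.

(** Stated from an arbitrary state of the body, so that induction on the run of the body goes
    through. *)
Lemma fruns_rep (A B : finType) (body : A -> frag (A + B)%type) (a0 a : A)
    (q : fq (body a)) t h n r t1 h1 n' l t2 h2 :
  fruns q t h n r t1 h1 ->
  (match r with
   | inl a' => runs (rep a' body) t1 h1 n' l t2 h2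
   | inr b => [/\ b = l, t1 = t2 & h1 = h2]
   end) ->
  @fruns _ (rep a0 body) (existT _ a q) t h (n + n').+1 l t2 h2.
Proof.
move=> H1 H2.
elim: H1 H2 => {t h n r t1 h1} [q1 t h n r E|q1 t h n r t' h' q' s mv E _ IH] H2.
  case: r E H2 => [a'|b] E H2.
    apply: (FStep (s := t h) (mv := MS)
      (q' := existT _ a' (fstart (body a')) : fq (rep a0 body))).
      by rewrite /= E.
    rewrite upd_same /=; apply: (@fruns_leq _ _ _ _ _ n'); last exact: leq_addl.
    rewrite /runs /= in H2.
    (* The machines [rep a' body] and [rep a0 body] differ only in their start state, so a run of
       one is a run of the other. *)
    have K : forall qq : fq (rep a' body), fruns qq t h n' l t2 h2 ->
       @fruns _ (rep a0 body) qq t h n' l t2 h2.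
      move=> qq; elim=> [q2 t3 h3 n3 l3 E3|q2 t3 h3 n3 l3 t4 h4 q3 s mv E3 _ IH].
        by apply: (@FExit _ (rep a0 body)).
      by apply: (@FStep _ (rep a0 body) _ _ _ _ _ _ _ _ _ _ E3).
    exact: K.
  case: H2 => <- <- <-; apply: FExit; by rewrite /= E.
by rewrite addSn; apply: FStep (IH H2); rewrite /= E.
Qed.

Lemma runs_rep_next (A B : finType) (body : A -> frag (A + B)%type) a a'
    t h n t1 h1 n' l t2 h2 :
  runs (body a) t h n (inl a') t1 h1 -> runs (rep a' body) t1 h1 n' l t2 h2 ->
  runs (rep a body) t h (n + n').+1 l t2 h2.
Proof. by move=> H1 H2; exact: (@fruns_rep _ _ body a a _ _ _ _ _ _ _ _ _ _ _ H1 H2). Qed.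

Lemma runs_rep_exit (A B : finType) (body : A -> frag (A + B)%type) a
    t h n l t1 h1 :
  runs (body a) t h n (inr l) t1 h1 -> runs (rep a body) t h n.+1 l t1 h1.
Proof. move=> H1; rewrite -(addn0 n).
exact: (@fruns_rep _ _ body a a _ _ _ _ _ _ _ 0 _ _ _ H1 (And3 erefl erefl erefl)). Qed.

Definition tm_of_frag (L : finType) (M : frag L) : TM :=
  MkTM #|fq M| (enum_rank (fstart M)) (fun q y =>
    match fdelta (enum_val q) y with
    | inl (q', s, mv) => Some (enum_rank q', s, mv)
    | inr _ => None
    end).

Lemma tm_of_frag_runs (L : finType) (M : frag L) t h n l t' h' :
  runs M t h n l t' h' ->
  exists k, k <= n /\ exists q, 
    tm_run (tm_of_frag M) k (Cfg (tm_of_frag M) (tm_start (tm_of_frag M)) t h)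
      = Some (Cfg (tm_of_frag M) q t' h') /\
    tm_step (tm_of_frag M) (Cfg (tm_of_frag M) q t' h') = None.
Proof.
rewrite /runs [tm_start _]/=; elim=> {t h n l t' h'} [q t h n l E
  |q t h n l t' h' q' s mv E _ [k [kn [q1 [E1 E2]]]]].
  exists 0; split=> //; exists (enum_rank q); split=> //.
  by rewrite /tm_step /= enum_rankK E.
exists k.+1; split=> //; exists q1; split=> //=.
by rewrite {1}/tm_step /= enum_rankK E.
Qed.

(** * Stacks on the tape *)

(* The stacks [ss], top first, each closed by a blank; [lay] instead opens each by a blank. *)
Definition segs (ss : seq (seq bool)) : seq (option bool) :=
  flatten [seq rcons (map Some s) None | s <- ss].
Definition lay (ss : seq (seq bool)) : seq (option bool) :=
  flatten [seq None :: map Some s | s <- ss].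

(** The blank that closes one stack opens the next, so the two layouts differ by one cell; shifting
    a stack by one cell passes between them. *)
Lemma lay_segs ss : rcons (lay ss) None = None :: segs ss.
Proof.
elim: ss => // s ss IH.
have -> : segs (s :: ss) = map Some s ++ rcons (lay ss) None by rewrite IH -cat_rcons.
by rewrite /lay /= rcons_cat.
Qed.

Lemma lay_cat s1 s2 : lay (s1 ++ s2) = lay s1 ++ lay s2.
Proof. by rewrite /lay map_cat flatten_cat. Qed.
Lemma segs_cat s1 s2 : segs (s1 ++ s2) = segs s1 ++ segs s2.
Proof. by rewrite /segs map_cat flatten_cat. Qed.

Notation tl l := (nth (@None bool) l) (only parsing).

Lemma nth_rcons_None (l : seq (option bool)) : tl (rcons l None) = tl l.
Proof.
apply: functional_extensionality => p; rewrite nth_rcons.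
by case: (ltnP p (size l)) => // h; rewrite (nth_default _ h); case: ifP.
Qed.

Lemma upd_cat (pre post : seq (option bool)) x y :
  upd (tl (pre ++ y :: post)) (size pre) x = tl (pre ++ x :: post).
Proof.
apply: functional_extensionality => p; rewrite /upd !nth_cat.
case: (ltngtP p (size pre)) => // h; last by rewrite h subnn.
by rewrite -(subnSK h).
Qed.

Lemma nth_here (pre post : seq (option bool)) y :
  nth None (pre ++ y :: post) (size pre) = y.
Proof. by rewrite nth_cat ltnn subnn. Qed.

Lemma runs_act_at (L : finType) (f : option bool -> option bool * move * L)
    pre y post s mv l h : 
  f y = (s, mv, l) -> h = size pre ->
  runs (act f) (tl (pre ++ y :: post)) h 1 l (tl (pre ++ s :: post)) (mvh mv h).
Proof.
move=> E ->; have := runs_act f (tl (pre ++ y :: post)) (size pre) 0.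
by rewrite nth_here E /= upd_cat.
Qed.

Definition skipR : frag unit := rep (A := unit) (B := unit) tt (fun _ =>
  act (fun y => (y, MR, if y is None then inr tt else inl tt))).
Definition shiftR (x : option bool) : frag unit :=
  rep (A := option bool) (B := unit) x (fun x =>
    act (fun y => (x, MR, if y is None then inr tt else inl y))).
Definition skipL : frag unit :=
  bind (act (fun y => (y, ML, tt))) (fun _ => rep (A := unit) (B := unit) tt (fun _ =>
  act (fun y => if y is None then (y, MS, inr tt) else (y, ML, inl tt)))).
Definition goL : frag unit := act (fun y => (y, ML, tt)).
Definition shiftL (x : option bool) : frag unit :=
  rep (A := option bool) (B := unit) x (fun x => bind goL (fun _ =>
    act (fun y => (x, MS, if y is None then inr tt else inl y)))).
(** On the way left, each cell receives the carried symbol and gives up its own. At the blank, the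
    symbol in hand is the top of the stack, and it is returned instead of written. *)
Definition deleteL (x : option bool) : frag (option bool) :=
  rep (A := option bool) (B := option bool) x (fun x => bind goL (fun _ =>
    act (fun y => if y is None then (None, MS, inr x) else (x, MS, inl y)))).

Lemma runs_skipR pre w post h h' :
  h = size pre -> h' = (size pre + size w).+1 ->
  runs skipR (tl (pre ++ map Some w ++ None :: post)) h (2 * (size w).+1) tt
    (tl (pre ++ map Some w ++ None :: post)) h'.
Proof.
elim: w pre h h' => [|b w IH] pre h h' -> -> /=.
  rewrite addn0; apply: runs_leq; first apply: runs_rep_exit.
    exact: (@runs_act_at _ _ pre None post None MR).
  by [].
apply: (@runs_leq _ _ _ _ (1 + (2 * (size w).+1)).+1); last by lia.
apply: runs_rep_next.
  exact: (@runs_act_at _ _ pre (Some b) _ (Some b) MR).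
rewrite -cat_rcons; apply: IH; rewrite ?size_rcons //=; lia.
Qed.

Lemma runs_shiftR x pre w post h h' :
  h = size pre -> h' = (size pre + size w).+1 ->
  runs (shiftR x) (tl (pre ++ map Some w ++ None :: post)) h (2 * (size w).+1) tt
    (tl (pre ++ x :: map Some w ++ post)) h'.
Proof.
elim: w x pre h h' => [|b w IH] x pre h h' -> -> /=.
  rewrite addn0; apply: runs_leq; first apply: runs_rep_exit.
    exact: (@runs_act_at _ _ pre None post x MR).
  by [].
apply: (@runs_leq _ _ _ _ (1 + (2 * (size w).+1)).+1); last by lia.
apply: runs_rep_next.
  exact: (@runs_act_at _ _ pre (Some b) _ x MR).
rewrite -!(cat_rcons x); apply: IH; rewrite ?size_rcons //=; lia.
Qed.

Lemma runs_goL_any (l : seq (option bool)) h :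
  runs goL (tl l) h 1 tt (tl l) h.-1.
Proof.
have := runs_act (fun y => (y, ML, tt)) (tl l) h 0.
by rewrite upd_same.
Qed.

Lemma runs_skipL pre w post h h' :
  h = (size pre + size w).+1 -> h' = size pre ->
  runs skipL (tl (pre ++ None :: map Some w ++ post)) h (2 * (size w).+2) tt
    (tl (pre ++ None :: map Some w ++ post)) h'.
Proof.
move=> -> ->; apply: (@runs_leq _ _ _ _ (1 + (2 * (size w).+1)).+1); last by lia.
apply: runs_bind; first exact: runs_goL_any.
elim/last_ind: w post => [|w b IH] post /=.
  rewrite addn0; apply: runs_leq; first apply: runs_rep_exit.
    exact: (@runs_act_at _ _ pre None post None MS).
  by [].
rewrite size_rcons map_rcons cat_rcons addnS /=.
apply: (@runs_leq _ _ _ _ (1 + (2 * (size w).+1)).+1); last by lia.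
apply: runs_rep_next; last exact: IH.
rewrite -cat_cons catA; apply: (@runs_act_at _ _ _ _ _ (Some b) ML) => //.
by rewrite size_cat /= size_map; lia.
Qed.

Lemma runs_shiftL x pre w post h h' :
  h = (size pre + size w).+1 -> h' = size pre ->
  runs (shiftL x) (tl (pre ++ None :: map Some w ++ post)) h (4 * (size w).+1) tt
    (tl (pre ++ map Some w ++ x :: post)) h'.
Proof.
move=> -> ->; elim/last_ind: w x post => [|w b IH] x post /=.
  rewrite addn0; apply: runs_leq; first apply: runs_rep_exit.
    apply: runs_bind; first exact: runs_goL_any.
    exact: (@runs_act_at _ _ pre None post x MS).
  by [].
rewrite size_rcons map_rcons !cat_rcons addnS /=.
apply: (@runs_leq _ _ _ _ ((1 + 1).+1 + (4 * (size w).+1)).+1); last by lia.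
apply: runs_rep_next; last exact: IH.
apply: runs_bind; first exact: runs_goL_any.
rewrite -!cat_cons !catA; apply: (@runs_act_at _ _ _ _ _ x MS) => //.
by rewrite size_cat /= size_map; lia.
Qed.

Lemma runs_deleteL x b pre w post h h' :
  h = (size pre + size w).+2 -> h' = size pre ->
  runs (deleteL x) (tl (pre ++ None :: map Some (b :: w) ++ post)) h
    (4 * (size w).+2) (Some b)
    (tl (pre ++ None :: map Some w ++ x :: post)) h'.
Proof.
move=> -> ->; elim/last_ind: w x post => [|w c IH] x post /=.
  rewrite addn0.
  apply: (@runs_leq _ _ _ _ ((1 + 1).+1 + (1 + 1).+2).+1); last by lia.
  apply: runs_rep_next.
    apply: runs_bind; first exact: runs_goL_any.
    rewrite -cat_rcons; apply: (@runs_act_at _ _ _ _ _ x MS) => //.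
    by rewrite size_rcons.
  rewrite cat_rcons; apply: runs_rep_exit.
  apply: runs_bind; first exact: runs_goL_any.
  exact: (@runs_act_at _ _ pre None _ None MS).
rewrite size_rcons map_rcons !cat_rcons addnS /=.
apply: (@runs_leq _ _ _ _ ((1 + 1).+1 + (4 * (size w).+2)).+1); last by lia.
apply: runs_rep_next; last exact: IH.
apply: runs_bind; first exact: runs_goL_any.
rewrite -!cat_cons !catA; apply: (@runs_act_at _ _ _ _ _ x MS) => //.
by rewrite size_cat /= size_map; lia.
Qed.

Fixpoint nrep (n : nat) (M : frag unit) : frag unit :=
  if n is n'.+1 then bind M (fun _ => nrep n' M) else ret tt.

Lemma segs_cons w ss : segs (w :: ss) = rcons (map Some w) None ++ segs ss.
Proof. by []. Qed.
Lemma lay_cons w ss : lay (w :: ss) = None :: map Some w ++ lay ss.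
Proof. by []. Qed.
Lemma segs_rcons ss w : segs (rcons ss w) = segs ss ++ rcons (map Some w) None.
Proof. by rewrite -cats1 segs_cat segs_cons cats0. Qed.
Lemma lay_rcons ss w : lay (rcons ss w) = lay ss ++ None :: map Some w.
Proof. by rewrite -cats1 lay_cat lay_cons cats0. Qed.

Lemma segs_nil_cons ss : None :: segs ss = segs ([::] :: ss).
Proof. by []. Qed.
Lemma segs_nil : segs [::] = [::]. Proof. by []. Qed.
Lemma lay_nil : lay [::] = [::]. Proof. by []. Qed.
Opaque segs lay.

Lemma size_segs ss : size (segs ss) = size (lay ss).
Proof. by have /(congr1 size) := lay_segs ss; rewrite size_rcons => -[]. Qed.

Lemma runs_skipRn ss pre post h h' :
  h = size pre -> h' = size pre + size (segs ss) ->
  runs (nrep (size ss) skipR) (tl (pre ++ segs ss ++ post)) h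
    (3 * size (segs ss)) tt (tl (pre ++ segs ss ++ post)) h'.
Proof.
elim: ss pre h h' => [|w ss IH] pre h h' -> -> /=.
  by rewrite ?segs_nil ?lay_nil addn0; apply: runs_ret.
rewrite segs_cons size_cat size_rcons size_map.
apply: (@runs_leq _ _ _ _ (2 * (size w).+1 + 3 * size (segs ss)).+1); last by lia.
rewrite -catA; apply: runs_bind.
  rewrite cat_rcons; exact: runs_skipR.
rewrite -cat_rcons !(catA pre); apply: IH; rewrite size_cat size_rcons size_map; lia.
Qed.

Lemma runs_shiftRn ss pre post h h' :
  h = size pre -> h' = size pre + size (lay ss) ->
  runs (nrep (size ss) (shiftR None)) (tl (pre ++ segs ss ++ post)) h
    (3 * size (lay ss)) tt (tl (pre ++ lay ss ++ post)) h'.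
Proof.
elim: ss pre h h' => [|w ss IH] pre h h' -> ->.
  by rewrite ?segs_nil ?lay_nil addn0; apply: runs_ret.
rewrite segs_cons lay_cons /= size_cat size_map.
apply: (@runs_leq _ _ _ _ (2 * (size w).+1 + 3 * size (lay ss)).+1); last by lia.
rewrite -!catA; apply: runs_bind.
  rewrite cat_rcons; exact: runs_shiftR.
rewrite -!cat_cons !(catA pre); apply: IH; rewrite size_cat /= size_map; lia.
Qed.

Lemma runs_skipLn ss pre post h h' :
  h = size pre + size (lay ss) -> h' = size pre ->
  runs (nrep (size ss) skipL) (tl (pre ++ lay ss ++ post)) h
    (5 * size (lay ss)) tt (tl (pre ++ lay ss ++ post)) h'.
Proof.
elim/last_ind: ss post h h' => [|ss w IH] post h h' -> ->.
  by rewrite ?segs_nil ?lay_nil addn0; apply: runs_ret.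
rewrite size_rcons lay_rcons size_cat /= size_map.
apply: (@runs_leq _ _ _ _ (2 * (size w).+2 + 5 * size (lay ss)).+1); last by lia.
rewrite -!catA; apply: runs_bind.
  rewrite catA; apply: runs_skipL; last by [].
  by rewrite size_cat; lia.
by rewrite -catA; apply: IH; rewrite // size_cat.
Qed.

Lemma runs_shiftLn ss pre post h h' :
  h = size pre + size (lay ss) -> h' = size pre ->
  runs (nrep (size ss) (shiftL None)) (tl (pre ++ lay ss ++ post)) h
    (5 * size (lay ss)) tt (tl (pre ++ segs ss ++ post)) h'.
Proof.
elim/last_ind: ss post h h' => [|ss w IH] post h h' -> ->.
  by rewrite ?segs_nil ?lay_nil addn0; apply: runs_ret.
rewrite size_rcons lay_rcons segs_rcons size_cat /= size_map.
apply: (@runs_leq _ _ _ _ (4 * (size w).+1 + 5 * size (lay ss)).+1); last by lia.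
rewrite -!catA; apply: runs_bind.
  rewrite catA; apply: runs_shiftL; last by [].
  by rewrite size_cat; lia.
by rewrite -!catA cat_rcons; apply: IH; rewrite // size_cat.
Qed.

(** * Pushing and popping on a tape of stacks *)

Definition tp (ss : seq (seq bool)) : tape := tl (lay ss).
Definition tot (ss : seq (seq bool)) : nat := size (lay ss).

(** The head rests on cell 0, the blank opening the first stack. Passing [j.+1] blanks reaches the
    top of stack [j]; the content of that stack and the [K - j.+1] stacks after it then move right
    by one cell. *)
Definition pushf (K j : nat) (b : bool) : frag unit :=
  bind (nrep j.+1 skipR) (fun _ => bind (shiftR (Some b)) (fun _ =>
  bind (nrep (K - j.+1) (shiftR None)) (fun _ => nrep K skipL))).

(** A blank at the top position means that stack [j] is empty. Otherwise the shift starts at the far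
    end: the stacks after [j] move left by one cell, and then [deleteL] takes the top off stack
    [j]. *)
Definition popf (K j : nat) : frag (option bool) :=
  bind (nrep j.+1 skipR) (fun _ => bind (act (fun y => (y, MS, y))) (fun y =>
  if y is None then bind (nrep j.+1 skipL) (fun _ => ret None)
  else bind (nrep (K - j) skipR) (fun _ => bind goL (fun _ =>
       bind (nrep (K - j.+1) (shiftL None)) (fun _ =>
       bind (deleteL None) (fun b => bind (nrep j skipL) (fun _ => ret b))))))).

(** The tape is blank beyond the stacks, so a closing blank may be appended; the blank on cell 0
    then reads as an empty stack in the [segs] layout. *)
Lemma tp_split ss1 s ss2 :
  tp (ss1 ++ s :: ss2) = tl (segs ([::] :: ss1) ++ map Some s ++ None :: segs ss2).
Proof.
rewrite /tp -nth_rcons_None lay_segs segs_nil_cons -cat_cons segs_cat.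
by rewrite -cat_rcons.
Qed.

Lemma tot_split ss1 s ss2 : tot (ss1 ++ s :: ss2) = tot ss1 + (size s).+1 + tot ss2.
Proof. by rewrite /tot lay_cat lay_cons !size_cat /= size_cat size_map; lia. Qed.

Lemma runs_pushf b ss1 s ss2 :
  runs (pushf (size (ss1 ++ s :: ss2)) (size ss1) b) (tp (ss1 ++ s :: ss2)) 0
    (14 * (tot (ss1 ++ s :: ss2)).+1) tt (tp (ss1 ++ (b :: s) :: ss2)) 0.
Proof.
set K := size _; set N := tot _.
have EN : N = tot ss1 + (size s).+1 + tot ss2 by rewrite /N tot_split.
have EK : K - (size ss1).+1 = size ss2 by rewrite /K size_cat /=; lia.
rewrite tp_split /pushf EK.
apply: (@runs_leq _ _ _ _ (3 * size (segs ([::] :: ss1)) + (2 * (size s).+1 +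
   (3 * size (lay ss2) + 5 * size (lay (ss1 ++ (b :: s) :: ss2))).+1).+1).+1); last first.
  rewrite -!/(tot _) tot_split -segs_nil_cons /= size_segs -!/(tot _); lia.
apply: runs_bind.
  exact: (@runs_skipRn ([::] :: ss1) [::]).
apply: runs_bind; first exact: runs_shiftR.
rewrite -cat_cons catA -[segs ss2]cats0.
apply: runs_bind.
  apply: runs_shiftRn => //; rewrite size_cat /= size_map; lia.
rewrite cats0 -segs_nil_cons -lay_segs -cats1 -!catA /=.
have -> : lay ss1 ++ None :: Some b :: map Some s ++ lay ss2 = lay (ss1 ++ (b :: s) :: ss2).
  by rewrite lay_cat.
have -> : K = size (ss1 ++ (b :: s) :: ss2) by rewrite /K !size_cat.
have := @runs_skipLn (ss1 ++ (b :: s) :: ss2) [::] [::]; rewrite cats0; apply=> //.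
rewrite lay_cat lay_cons !size_cat /= size_cat size_map; lia.
Qed.

Lemma runs_popf_nil ss1 ss2 :
  runs (popf (size (ss1 ++ [::] :: ss2)) (size ss1)) (tp (ss1 ++ [::] :: ss2)) 0
    (24 * (tot (ss1 ++ [::] :: ss2)).+1) None (tp (ss1 ++ [::] :: ss2)) 0.
Proof.
set K := size _; set N := tot _.
have EN : N = tot ss1 + 1 + tot ss2 by rewrite /N tot_split.
rewrite tp_split /popf.
apply: (@runs_leq _ _ _ _ (3 * size (segs ([::] :: ss1)) + (1 +
   (5 * size (lay (ss1 ++ [:: [::]])) + 0).+1).+1).+1); last first.
  rewrite -!/(tot _) tot_split -segs_nil_cons /= size_segs -!/(tot _) /=.
  have -> : tot [::] = 0 by rewrite /tot lay_nil. lia.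
apply: runs_bind.
  exact: (@runs_skipRn ([::] :: ss1) [::]).
apply: runs_bind.
  by apply: (@runs_act_at _ _ (segs ([::] :: ss1)) None _ None MS None).
apply: (@runs_bind _ _ _ _ _ _ _ tt); last exact: runs_ret.
have E : segs ([::] :: ss1) = lay (ss1 ++ [:: [::]]).
  by rewrite -segs_nil_cons -lay_segs lay_cat cats1.
have -> : (size ss1).+1 = size (ss1 ++ [:: [::]]) by rewrite size_cat /= addn1.
by rewrite E; apply: (@runs_skipLn _ [::]) => //; rewrite E.
Qed.

Lemma runs_popf_cons b ss1 s ss2 :
  runs (popf (size (ss1 ++ (b :: s) :: ss2)) (size ss1)) (tp (ss1 ++ (b :: s) :: ss2)) 0
    (24 * (tot (ss1 ++ (b :: s) :: ss2)).+1) (Some b) (tp (ss1 ++ s :: ss2)) 0.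
Proof.
set K := size _; set N := tot _.
have EN : N = tot ss1 + (size s).+2 + tot ss2 by rewrite /N tot_split.
have EK : K - (size ss1).+1 = size ss2 by rewrite /K size_cat /=; lia.
have EK' : K - (size ss1) = size ((b :: s) :: ss2) by rewrite /K size_cat /=; lia.
rewrite [in X in runs _ X]tp_split /popf EK EK'.
apply: (@runs_leq _ _ _ _ (3 * size (segs ([::] :: ss1)) + (1 +
   (3 * size (segs ((b :: s) :: ss2)) + (1 + (5 * size (lay ss2) + (4 * (size s).+2 +
     (5 * size (lay ss1) + 0).+1).+1).+1).+1).+1).+1).+1); last first.
  rewrite !size_segs -!/(tot _).
  have -> : tot ([::] :: ss1) = (tot ss1).+1 by rewrite /tot lay_cons.
  have -> : tot ((b :: s) :: ss2) = (size s).+2 + tot ss2 by rewrite (@tot_split [::]) /tot lay_nil.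
  lia.
apply: runs_bind.
  exact: (@runs_skipRn ([::] :: ss1) [::]).
apply: runs_bind.
  by apply: (@runs_act_at _ _ (segs ([::] :: ss1)) (Some b) _ (Some b) MS (Some b)).
cbv iota beta.
have E1 : map Some (b :: s) ++ None :: segs ss2 = segs ((b :: s) :: ss2).
  by rewrite -cat_rcons.
rewrite [Some b :: _]E1 -[segs ([::] :: ss1) ++ segs _]cats0 -catA.
apply: runs_bind.
  exact: runs_skipRn.
rewrite cats0 -E1 -lay_segs.
apply: runs_bind; first exact: runs_goL_any.
rewrite catA -cats1; apply: runs_bind.
  apply: runs_shiftLn => //.
  rewrite !size_cat /=; lia.
rewrite -segs_nil_cons -lay_segs cat_rcons.
apply: runs_bind.
  rewrite -!catA cat_cons; apply: runs_deleteL => //.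
  rewrite size_cat /= size_map; lia.
apply: (@runs_bind _ _ _ _ _ _ _ tt); last exact: runs_ret.
have -> : tp (ss1 ++ s :: ss2) =
  tl (lay ss1 ++ None :: map Some s ++ None :: segs ss2 ++ [:: None]).
  rewrite tp_split -segs_nil_cons -lay_segs cat_rcons cats1 -nth_rcons_None.
  by rewrite rcons_cat /= rcons_cat.
exact: (@runs_skipLn _ [::]).
Qed.

(* [n] counts stack operations; each of them takes time linear in the tape length. *)
Definition sruns (L : finType) (F : frag L) (s : seq (seq bool)) (n : nat) (l : L)
    (s' : seq (seq bool)) : Prop :=
  [/\ 0 < n, tot s' <= tot s + n
    & runs F (tp s) 0 (30 * n * (tot s + n)) l (tp s') 0].

Lemma sruns_leq (L : finType) (F : frag L) s n l s' m :
  sruns F s n l s' -> n <= m -> sruns F s m l s'.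
Proof.
move=> [n0 ts r] nm; split; [lia | lia |].
by apply: runs_leq r _; apply: leq_mul; lia.
Qed.

(* [n1 > 0] and [n2 > 0] leave slack in the quadratic bound, which absorbs the
   jump from [M] to [k l]. *)
Lemma sruns_cost z z1 n1 n2 : 0 < n1 -> 0 < n2 -> z1 <= z + n1 ->
  (30 * n1 * (z + n1) + 30 * n2 * (z1 + n2)).+1 <= 30 * (n1 + n2) * (z + (n1 + n2)).
Proof. by move=> *; nia. Qed.

Lemma sruns_bind (L L' : finType) (M : frag L) (k : L -> frag L') s n l s1 n' l' s2 :
  sruns M s n l s1 -> sruns (k l) s1 n' l' s2 -> sruns (bind M k) s (n + n') l' s2.
Proof.
move=> [n0 ts r] [n0' ts' r']; split; [lia | lia |].
apply: runs_leq (runs_bind r r') _; exact: sruns_cost.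
Qed.

Lemma sruns_rep_next (A B : finType) (body : A -> frag (A + B)%type) a a' s n s1 n' l s2 :
  sruns (body a) s n (inl a') s1 -> sruns (rep a' body) s1 n' l s2 ->
  sruns (rep a body) s (n + n') l s2.
Proof.
move=> [n0 ts r] [n0' ts' r']; split; [lia | lia |].
apply: runs_leq (runs_rep_next r r') _; exact: sruns_cost.
Qed.

Lemma sruns_rep_exit (A B : finType) (body : A -> frag (A + B)%type) a s n l s1 :
  sruns (body a) s n (inr l) s1 -> sruns (rep a body) s n.+1 l s1.
Proof.
move=> [n0 ts r]; split; [lia | lia |].
by apply: runs_leq (runs_rep_exit r) _; nia.
Qed.

Lemma sruns_ret (L : finType) (l : L) s : sruns (ret l) s 1 l s.
Proof. by split=> //; [lia | exact: runs_ret]. Qed.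

Definition push := pushf 4.
Definition pop := popf 4.

Lemma set_nth_split (s : seq (seq bool)) j : j < size s ->
  exists s1 s2, s = s1 ++ nth [::] s j :: s2 /\ size s1 = j /\
    forall x, set_nth [::] s j x = s1 ++ x :: s2.
Proof.
move=> js; exists (take j s), (drop j.+1 s); split; last split.
- by rewrite -drop_nth // cat_take_drop.
- by rewrite size_takel // ltnW.
- by move=> x; rewrite set_nthE js.
Qed.

(** A push takes at most [14 * (tot s).+1] machine steps and a pop at most [24 * (tot s).+1]; the
    factor 30 in [sruns] covers both. *)
Lemma sruns_push j b s : size s = 4 -> j < 4 ->
  sruns (push j b) s 1 tt (set_nth [::] s j (b :: nth [::] s j)).
Proof.
move=> s4 j4; have /set_nth_split[s1 [s2 [E [E1 ->]]]] : j < size s by rewrite s4.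
have := runs_pushf b s1 (nth [::] s j) s2; rewrite -E s4 E1 => r.
split=> //; last by apply: runs_leq r _; lia.
have -> : tot s = tot s1 + (size (nth [::] s j)).+1 + tot s2 by rewrite {1}E tot_split.
by rewrite tot_split /=; lia.
Qed.

Lemma sruns_pop j b r s : size s = 4 -> j < 4 -> nth [::] s j = b :: r ->
  sruns (pop j) s 1 (Some b) (set_nth [::] s j r).
Proof.
move=> s4 j4 N; have /set_nth_split[s1 [s2 [E [E1 ->]]]] : j < size s by rewrite s4.
have := runs_popf_cons b s1 r s2; rewrite -N -E s4 E1 => R.
split=> //; last by apply: runs_leq R _; lia.
have -> : tot s = tot s1 + (size (nth [::] s j)).+1 + tot s2 by rewrite {1}E tot_split.
by rewrite N tot_split /=; lia.
Qed.

Lemma sruns_pop_nil j s : size s = 4 -> j < 4 -> nth [::] s j = [::] ->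
  sruns (pop j) s 1 None s.
Proof.
move=> s4 j4 N; have /set_nth_split[s1 [s2 [E [E1 _]]]] : j < size s by rewrite s4.
have := runs_popf_nil s1 s2; rewrite -N -E s4 E1 => R.
by split=> //; [lia | apply: runs_leq R _; lia].
Qed.

Notation "c1 ';;' c2" := (bind c1 (fun _ => c2)) (at level 61, right associativity).

Ltac pushs := apply: sruns_bind; [by apply: sruns_push | rewrite /=].
Ltac pops := apply: sruns_bind; [by apply: sruns_pop; reflexivity | rewrite /=].
Ltac popn := apply: sruns_bind; [by apply: sruns_pop_nil | rewrite /=].

(** * Trees on the stack *)

Inductive tree := Lf | Nd of tree & tree.

Fixpoint tenc (t : tree) : seq bool :=
  if t is Nd a b then true :: tenc a ++ tenc b else [:: false].
Definition tsz t := size (tenc t).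

(* What remains on a stack after pushing each bit of [w] in turn, followed by [true]
   as a mark that an entry follows; [fm] is the same with the first bit on top. *)
Fixpoint mk (w r : seq bool) : seq bool :=
  if w is b :: w' then mk w' (true :: b :: r) else r.
Fixpoint fm (w r : seq bool) : seq bool :=
  if w is b :: w' then true :: b :: fm w' r else r.

Lemma mk_cat w1 w2 r : mk (w1 ++ w2) r = mk w2 (mk w1 r).
Proof. by elim: w1 r => //=. Qed.
Lemma mk_rcons w b r : mk (rcons w b) r = true :: b :: mk w r.
Proof. by rewrite -cats1 mk_cat. Qed.

Lemma fm_rcons w b r : fm (rcons w b) r = fm w (true :: b :: r).
Proof. by elim: w => //= c w ->. Qed.

Definition ix (j : bool) : nat := if j then 2 else 1.
(** Stacks 1 and 2 play symmetric roles: [x] is the content of the one selected by [j] and [c] that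
    of the other, so one lemma serves both. *)
Definition st (j : bool) (a x c d : seq bool) : seq (seq bool) :=
  if j then [:: a; c; x; d] else [:: a; x; c; d].

(* Stack 3 counts in unary the subtrees still to be read. *)
Definition mvt_loop (j : bool) : frag unit :=
  rep (A := unit) (B := unit) tt (fun _ => bind (pop 3) (fun y =>
    if y is Some _ then bind (pop 0) (fun b =>
      push (ix j) (b == Some true) ;; push (ix j) true ;;
      (if b == Some true then push 3 true ;; push 3 true ;; ret (inl tt) else ret (inl tt)))
    else ret (inr tt))).

Definition mvt (j : bool) : frag unit :=
  push (ix j) false ;; push 3 true ;; mvt_loop j.

(** The rest of the run is a hypothesis, so the two subtrees of a node chain: the run on the right
    one continues the run on the left one. A node costs seven operations and a leaf five. *)
Lemma mvt_loop_tree j t a x c k n s' :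
  sruns (mvt_loop j) (st j a (mk (tenc t) x) c (nseq k true)) n tt s' ->
  sruns (mvt_loop j) (st j (tenc t ++ a) x c (nseq k.+1 true)) (7 * tsz t + n) tt s'.
Proof.
elim: t a x k n s' => [|t1 IH1 t2 IH2] a x k n s' H.
  apply: sruns_rep_next H.
  apply: (@sruns_leq _ _ _ (1 + (1 + (1 + (1 + 1)))));  last by [].
  case: j => /=; do 2! pops; do 2! pushs; exact: sruns_ret.
apply: (@sruns_leq _ _ _ (7 + (7 * tsz t1 + (7 * tsz t2 + n)))); last first.
  by rewrite /tsz /= size_cat; lia.
apply: (@sruns_rep_next _ _ _ tt tt _ _
   (st j (tenc t1 ++ tenc t2 ++ a) (true :: true :: x) c (nseq k.+2 true))).
  apply: (@sruns_leq _ _ _ (1 + (1 + (1 + (1 + (1 + (1 + 1)))))));  last by [].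
  by case: j {H IH1 IH2} => /=; rewrite -catA; do 2! pops; do 4! pushs; exact: sruns_ret.
apply: IH1; apply: IH2; by rewrite /= mk_cat in H.
Qed.

Lemma sruns_mvt j t a x c :
  sruns (mvt j) (st j (tenc t ++ a) x c [::]) (7 * tsz t + 5) tt
    (st j a (mk (tenc t) (false :: x)) c [::]).
Proof.
apply: (@sruns_leq _ _ _ (1 + (1 + (7 * tsz t + 3)))); last by lia.
apply: (@sruns_bind _ _ _ _ _ _ tt (st j (tenc t ++ a) (false :: x) c [::])).
  by case: j => /=; apply: sruns_push.
apply: (@sruns_bind _ _ _ _ _ _ tt (st j (tenc t ++ a) (false :: x) c [:: true])).
  by case: j => /=; apply: sruns_push.
apply: (@mvt_loop_tree _ _ _ _ _ 0).
apply: (@sruns_rep_exit _ _ _ _ _ (1 + 1)).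
case: j => /=; popn; exact: sruns_ret.
Qed.

(* Pops the entries written by [mvt], last bit first, down to the [false] mark. *)
Definition unmark (j : bool) (k : bool -> frag unit) : frag unit :=
  rep (A := unit) (B := unit) tt (fun _ => bind (pop (ix j)) (fun y =>
    if y == Some true then bind (pop (ix j)) (fun b =>
      k (b == Some true) ;; ret (inl tt)) else ret (inr tt))).

Definition back j := unmark j (push 0).

Lemma sruns_unmark_exit j k a x c d :
  sruns (unmark j k) (st j a (false :: x) c d) 3 tt (st j a x c d).
Proof.
apply: (@sruns_rep_exit _ _ _ _ _ (1 + 1)).
case: j => /=; pops; exact: sruns_ret.
Qed.

Lemma sruns_unmark_next j k b a x c d m a' c' n s' :
  sruns (k b) (st j a x c d) m tt (st j a' x c' d) ->
  sruns (unmark j k) (st j a' x c' d) n tt s' ->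
  sruns (unmark j k) (st j a (true :: b :: x) c d) (m + 3 + n) tt s'.
Proof.
move=> H; apply: (@sruns_rep_next _ _ _ tt tt).
apply: (@sruns_leq _ _ _ (1 + (1 + (m + 1)))); last by lia.
have bE : (Some b == Some true) = b by case: b H.
case: j H => /= H; do 2! pops; rewrite bE; (apply: sruns_bind; [exact: H | exact: sruns_ret]).
Qed.

Lemma sruns_back j w a x c d :
  sruns (back j) (st j a (mk w (false :: x)) c d) (4 * size w + 3) tt
    (st j (w ++ a) x c d).
Proof.
elim/last_ind: w a => [|w b IH] a; first exact: sruns_unmark_exit.
rewrite mk_rcons size_rcons cat_rcons.
apply: (@sruns_leq _ _ _ (1 + 3 + (4 * size w + 3))); last by lia.
apply: sruns_unmark_next (IH _).
case: j {IH}; exact: sruns_push.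
Qed.

Definition dropt : frag unit := mvt false ;; unmark false (fun _ => ret tt).

Lemma sruns_dropt t a x c :
  sruns dropt [:: tenc t ++ a; x; c; [::]] (11 * tsz t + 8) tt [:: a; x; c; [::]].
Proof.
apply: (@sruns_leq _ _ _ ((7 * tsz t + 5) + (4 * tsz t + 3))); last by lia.
apply: sruns_bind; first exact: (sruns_mvt false).
rewrite /tsz; elim/last_ind: (tenc t) => [|w b IH]; first exact: (sruns_unmark_exit false).
rewrite mk_rcons size_rcons.
apply: (@sruns_leq _ _ _ (1 + 3 + (4 * size w + 3))); last by lia.
apply: (@sruns_unmark_next false _ _ _ _ _ _ _ a c) IH; exact: sruns_ret.
Qed.

(** Unloading stack 1 restores the tree on stack 0 and leaves a copy on stack 2 with its first bit
    on top. The transfer to stack 1 reverses the copy into the order that [back] expects. *)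
Definition dupt : frag unit :=
  mvt false ;; push 2 false ;;
  unmark false (fun b => push 0 b ;; push 2 b ;; push 2 true) ;;
  push 1 false ;;
  unmark true (fun b => push 1 b ;; push 1 true) ;;
  back false.

Lemma sruns_dupt t a x c :
  sruns dupt [:: tenc t ++ a; x; c; [::]] (25 * tsz t + 20) tt
    [:: tenc t ++ tenc t ++ a; x; c; [::]].
Proof.
apply: (@sruns_leq _ _ _ ((7 * tsz t + 5) + (1 + ((6 * tsz t + 3) + (1 +
  ((5 * tsz t + 3) + (4 * tsz t + 3))))))); last by lia.
apply: sruns_bind; first exact: (sruns_mvt false).
rewrite /=; pushs.
apply: (@sruns_bind _ _ _ _ _ _ tt [:: tenc t ++ a; x; fm (tenc t) (false :: c); [::]]).
  rewrite /tsz; elim/last_ind: (tenc t) a (false :: c) => [|w b IH] v y.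
    exact: (sruns_unmark_exit false).
  rewrite mk_rcons size_rcons cat_rcons fm_rcons.
  apply: (@sruns_leq _ _ _ (1 + (1 + 1) + 3 + (6 * size w + 3))); last by lia.
  apply: (@sruns_unmark_next false _ _ _ _ _ _ _ (b :: v) (true :: b :: y)); last exact: IH.
  by pushs; pushs; apply: sruns_push.
pushs.
apply: (@sruns_bind _ _ _ _ _ _ tt [:: tenc t ++ a; mk (tenc t) (false :: x); c; [::]]).
  rewrite /tsz; elim: (tenc t) (tenc t ++ a) (false :: x) => [|b w IH] v y.
    exact: (sruns_unmark_exit true).
  apply: (@sruns_leq _ _ _ (1 + 1 + 3 + (5 * size w + 3))); last by rewrite /=; lia.
  apply: (@sruns_unmark_next true _ _ _ _ _ _ _ v (true :: b :: y)).
    by pushs; apply: sruns_push.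
  exact: IH.
exact: (sruns_back false).
Qed.

Definition swapt : frag unit := mvt false ;; mvt true ;; back false ;; back true.

Lemma sruns_swapt t u a x c :
  sruns swapt [:: tenc t ++ tenc u ++ a; x; c; [::]] (11 * (tsz t + tsz u) + 16) tt
    [:: tenc u ++ tenc t ++ a; x; c; [::]].
Proof.
apply: (@sruns_leq _ _ _ ((7 * tsz t + 5) + ((7 * tsz u + 5) + ((4 * tsz t + 3) +
  (4 * tsz u + 3))))); last by lia.
apply: sruns_bind; first exact: (sruns_mvt false).
apply: sruns_bind; first exact: (sruns_mvt true).
apply: sruns_bind; first exact: (sruns_back false).
exact: (sruns_back true).
Qed.

(** * Polynomial-time functions *)

Definition pb (q : nat -> nat) : Prop := exists c k, forall n, q n <= c * n.+1 ^ k.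

Lemma pb_leq q q' : pb q' -> (forall n, q n <= q' n) -> pb q.
Proof. by move=> [c [k H]] le; exists c, k => n; apply: leq_trans (le n) (H n). Qed.

Lemma pb_const m : pb (fun=> m).
Proof. by exists m, 0 => n; rewrite expn0 muln1. Qed.

Lemma pb_id : pb (fun n => n).
Proof. by exists 1, 1 => n; rewrite expn1 mul1n. Qed.

Lemma pb_add q q' : pb q -> pb q' -> pb (fun n => q n + q' n).
Proof.
move=> [c [k H]] [c' [k' H']]; exists (c + c'), (k + k') => n; rewrite mulnDl.
apply: leq_add; [apply: leq_trans (H n) _ | apply: leq_trans (H' n) _];
  by rewrite leq_mul2l leq_pexp2l ?orbT //; lia.
Qed.

Lemma pb_mul q q' : pb q -> pb q' -> pb (fun n => q n * q' n).
Proof.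
move=> [c [k H]] [c' [k' H']]; exists (c * c'), (k + k') => n.
by rewrite expnD mulnACA; apply: leq_mul.
Qed.

Lemma pb_exp q k : pb q -> pb (fun n => q n ^ k).
Proof.
move=> H; elim: k => [|k IH].
  by apply: pb_leq (pb_const 1) _ => n; rewrite expn0.
by apply: pb_leq (pb_mul H IH) _ => n; rewrite expnS.
Qed.

Lemma pb_S q : pb q -> pb (fun n => (q n).+1).
Proof. by move=> H; apply: pb_leq (pb_add H (pb_const 1)) _ => n; rewrite addn1. Qed.

Ltac pbs := repeat first
  [ apply: pb_const | apply: pb_id | apply: pb_S | apply: pb_add | apply: pb_mul
  | apply: pb_exp | assumption ].

Class Enc (A : Type) := code : A -> tree.

Definition sz A `{Enc A} (a : A) : nat := tsz (code a).
Arguments sz {A _} a : simpl never.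

#[export] Instance Enc_unit : Enc unit := fun=> Lf.
#[export] Instance Enc_bool : Enc bool := fun b => if b then Nd Lf Lf else Lf.
#[export] Instance Enc_nat : Enc nat := fun n => iter n (Nd Lf) Lf.
#[export] Instance Enc_prod A B `{Enc A} `{Enc B} : Enc (A * B)%type :=
  fun p => Nd (code p.1) (code p.2).
#[export] Instance Enc_seq A `{Enc A} : Enc (seq A) :=
  fun s => foldr (fun a t => Nd (code a) t) Lf s.

(** The remainders [r0], [r1], [r2] are arbitrary, so that fragments compose while other data wait
    on stacks 0, 1 and 2. Stack 3 is empty between operations, since [mvt] counts subtrees on it. *)
Definition tr (F : frag unit) (t : tree) (n : nat) (t' : tree) : Prop :=
  forall r0 r1 r2, sruns F [:: tenc t ++ r0; r1; r2; [::]] n tt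
                           [:: tenc t' ++ r0; r1; r2; [::]].

Definition poly A B `{Enc A} `{Enc B} (f : A -> B) : Prop :=
  exists F c k, forall a, tr F (code a) (c * (sz a).+1 ^ k) (code (f a)).
Arguments poly {A B _ _} f.

Lemma tsz_gt0 t : 0 < tsz t.
Proof. by case: t. Qed.

Lemma tr_size F t n t' : tr F t n t' -> tsz t' <= tsz t + n.
Proof.
move=> /(_ [::] [::] [::])[_ + _].
by rewrite !(@tot_split [::] _ [:: [::]; [::]; [::]]) !cats0 -!/(tsz _); lia.
Qed.

Lemma tr_leq F t n t' m : tr F t n t' -> n <= m -> tr F t m t'.
Proof. by move=> H nm r0 r1 r2; apply: sruns_leq (H _ _ _) nm. Qed.

Lemma poly_intro A B `{Enc A} `{Enc B} (f : A -> B) F q :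
  pb q -> (forall a, tr F (code a) (q (sz a)) (code (f a))) -> poly f.
Proof.
by move=> [c [k Hq]] H1; exists F, c, k => a; apply: tr_leq (H1 a) (Hq _).
Qed.

Lemma poly_size A B `{Enc A} `{Enc B} (f : A -> B) : poly f ->
  exists2 q, pb q & forall a, sz (f a) <= q (sz a).
Proof.
move=> [F [c [k Hf]]]; exists (fun n => n + c * n.+1 ^ k); first by pbs.
by move=> a; apply: tr_size (Hf a).
Qed.

Lemma leq_exp2l_base m n e : m <= n -> m ^ e <= n ^ e.
Proof. by case: e => // e mn; rewrite leq_exp2r. Qed.

Lemma leq_cexp c m n e : m <= n -> c * m.+1 ^ e <= c * n.+1 ^ e.
Proof. by move=> mn; rewrite leq_mul2l leq_exp2l_base ?orbT. Qed.

Fixpoint pushw (w : seq bool) : frag unit :=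
  if w is b :: w' then pushw w' ;; push 0 b else ret tt.

Lemma sruns_pushw w a x c d :
  sruns (pushw w) [:: a; x; c; d] (size w).+1 tt [:: w ++ a; x; c; d].
Proof.
elim: w => [|b w IH] /=; first exact: sruns_ret.
by rewrite -addn1; apply: sruns_bind; [exact: IH | exact: sruns_push].
Qed.

Section Closure.
Context {A B C : Type} `{Enc A} `{Enc B} `{Enc C}.

(* Covers the identity and the conversions between types that share an encoding. *)
Lemma poly_cast (f : A -> B) : (forall a, code (f a) = code a) -> poly f.
Proof.
move=> E; apply: (@poly_intro _ _ _ _ _ (ret tt) (fun=> 1)); first by pbs.
by move=> a r0 r1 r2; rewrite E; apply: sruns_ret.
Qed.

Lemma poly_comp (f : A -> B) (g : B -> C) : poly f -> poly g -> poly (fun a => g (f a)).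
Proof.
move=> [F [c [k Hf]]] [G [c' [k' Hg]]].
apply: (@poly_intro _ _ _ _ _ (F ;; G)
  (fun n => c * n.+1 ^ k + c' * (n + c * n.+1 ^ k).+1 ^ k')); first by pbs.
move=> a r0 r1 r2; apply: sruns_bind; first exact: Hf.
apply: sruns_leq (Hg _ _ _ _) _; apply: leq_cexp; exact: tr_size (Hf a).
Qed.

Lemma poly_const (b : B) : poly (fun _ : A => b).
Proof.
apply: (@poly_intro _ _ _ _ _ (dropt ;; pushw (tenc (code b)))
  (fun n => (11 * n + 8) + (sz b).+1)); first by pbs.
move=> a r0 r1 r2; apply: sruns_bind; first exact: sruns_dropt.
exact: sruns_pushw.
Qed.

(** [g] runs first, because after the exchange [f a] has to end above [g a]: a pair is coded by
    [true], then its first component, then its second. *)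
Lemma poly_pair (f : A -> B) (g : A -> C) : poly f -> poly g -> poly (fun a => (f a, g a)).
Proof.
move=> [F [c [k Hf]]] [G [c' [k' Hg]]].
apply: (@poly_intro _ _ _ _ _ (dupt ;; G ;; swapt ;; F ;; push 0 true)
  (fun n => (25 * n + 20) + (c' * n.+1 ^ k' + (11 * ((n + c' * n.+1 ^ k') + n) + 16 +
     (c * n.+1 ^ k + 1))))); first by pbs.
move=> a r0 r1 r2; apply: sruns_bind; first exact: sruns_dupt.
apply: sruns_bind; first exact: Hg.
apply: sruns_bind.
  apply: sruns_leq (sruns_swapt _ _ _ _ _) _.
  by have := tr_size (Hg a); rewrite /sz; lia.
apply: sruns_bind; first exact: Hf.
by rewrite /= -catA; apply: sruns_push.
Qed.

Lemma poly_fstP : poly (fun p : A * B => p.1).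
Proof.
apply: (@poly_intro _ _ _ _ _ (pop 0 ;; mvt false ;; dropt ;; back false)
  (fun n => 1 + ((7 * n + 5) + ((11 * n + 8) + (4 * n + 3))))); first by pbs.
case=> a b r0 r1 r2.
have sa : tsz (code a) <= sz (a, b) by rewrite /sz /tsz /= size_cat; lia.
have sb : tsz (code b) <= sz (a, b) by rewrite /sz /tsz /= size_cat; lia.
rewrite /= -catA; pops.
apply: sruns_bind.
  by apply: sruns_leq (@sruns_mvt false _ _ _ _) _; rewrite leq_add2r leq_mul2l sa.
apply: sruns_bind.
  by apply: sruns_leq (sruns_dropt _ _ _ _) _; rewrite leq_add2r leq_mul2l sb.
by apply: sruns_leq (@sruns_back false _ _ _ _ _) _; rewrite leq_add2r leq_mul2l sa.
Qed.

Lemma poly_sndP : poly (fun p : A * B => p.2).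
Proof.
apply: (@poly_intro _ _ _ _ _ (pop 0 ;; dropt) (fun n => 1 + (11 * n + 8))); first by pbs.
case=> a b r0 r1 r2.
have sa : tsz (code a) <= sz (a, b) by rewrite /sz /tsz /= size_cat; lia.
rewrite /= -catA; pops.
by apply: sruns_leq (sruns_dropt _ _ _ _) _; rewrite leq_add2r leq_mul2l sa.
Qed.

(** A nonempty list has the same code as the pair of its head and tail. The two bits popped to
    inspect the list are therefore put back before [g] runs. *)
Lemma poly_matchP (f : B -> C) (g : (A * seq A) * B -> C) : poly f -> poly g ->
  poly (fun p : seq A * B => if p.1 is h :: t then g ((h, t), p.2) else f p.2).
Proof.
move=> [F [c [k Hf]]] [G [c' [k' Hg]]].
apply: (@poly_intro _ _ _ _ _ (pop 0 ;; bind (pop 0) (fun y =>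
   if y == Some true then push 0 true ;; push 0 true ;; G else F))
  (fun n => 1 + (1 + (1 + (1 + (c' * n.+1 ^ k' + c * n.+1 ^ k)))))); first by pbs.
case=> [[|h t] b] r0 r1 r2; rewrite /= -?catA; do 2! pops.
  apply: sruns_leq (Hf _ _ _ _) _.
  by rewrite !addnA; apply: leq_trans (leq_addl _ _); apply: leq_cexp; rewrite /sz /tsz /=; lia.
do 2! pushs; apply: (@sruns_leq _ _ _ (c' * (sz (h, t, b)).+1 ^ k')); last first.
  by apply: leq_trans (leq_addr _ _); apply: leq_cexp.
by have := Hg (h, t, b) r0 r1 r2; rewrite /= -!catA.
Qed.

End Closure.

Lemma poly_id A `{Enc A} : poly (fun a : A => a).
Proof. exact: poly_cast. Qed.

Section Applied.
Context {X A B C : Type} `{Enc X} `{Enc A} `{Enc B} `{Enc C}.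

Lemma poly_fst (f : X -> A * B) : poly f -> poly (fun x => (f x).1).
Proof. by move=> Hf; apply: (poly_comp Hf poly_fstP). Qed.

Lemma poly_snd (f : X -> A * B) : poly f -> poly (fun x => (f x).2).
Proof. by move=> Hf; apply: (poly_comp Hf poly_sndP). Qed.

Lemma poly_match (l : X -> seq A) (f : X -> C) (g : X -> A -> seq A -> C) :
  poly l -> poly f -> poly (fun p : (A * seq A) * X => g p.2 p.1.1 p.1.2) ->
  poly (fun x => if l x is h :: t then g x h t else f x).
Proof.
move=> Hl Hf Hg; have := poly_comp (poly_pair Hl poly_id) (poly_matchP Hf Hg).
exact.
Qed.

Lemma poly_cons (a : X -> A) (l : X -> seq A) :
  poly a -> poly l -> poly (fun x => a x :: l x).
Proof.
move=> Ha Hl; apply: (poly_comp (poly_pair Ha Hl) (g := fun p => p.1 :: p.2)).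
exact: poly_cast.
Qed.

End Applied.

Section If.
Context {X C : Type} `{Enc X} `{Enc C}.

Lemma poly_if (c : X -> bool) (f g : X -> C) :
  poly c -> poly f -> poly g -> poly (fun x => if c x then f x else g x).
Proof.
move=> Hc Hf Hg.
(* A boolean and the list of zero or one unit have the same code, so branching is case analysis on a
   list. *)
have Hn : poly (fun b : bool => nseq b tt) by apply: poly_cast; case.
have := @poly_match X unit C _ _ _ _ g (fun x _ _ => f x) (poly_comp Hc Hn) Hg.
have Hf' : poly (fun p : (unit * seq unit) * X => f p.2) by exact: (poly_comp poly_sndP Hf).
move/(_ Hf') => [F [k [m HH]]]; exists F, k, m => x.
by have := HH x; case: (c x).
Qed.

End If.

Section SizePair.
Context {A E : Type} `{Enc A} `{Enc E}.

Lemma sz_cons (e : E) (s : seq E) : sz (e :: s) = (sz e + sz s).+1.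
Proof. by rewrite /sz /tsz /= size_cat. Qed.

Lemma sz_pair (a : A) (e : E) : sz (a, e) = (sz a + sz e).+1.
Proof. by rewrite /sz /tsz /= size_cat. Qed.

End SizePair.

(** Stack 0 holds the remaining list above the pair of parameter and accumulator. In each round the
    head is joined to that pair, while the tail waits on stack 2. *)
Definition fold_loop (G : frag unit) : frag unit :=
  rep (A := unit) (B := unit) tt (fun _ => bind (pop 0) (fun y =>
    if y == Some true then
      mvt false ;; mvt true ;; back false ;; push 0 true ;; G ;; back true ;; ret (inl tt)
    else ret (inr tt))).

Section Fold.
Context {X A E : Type} `{Enc X} `{Enc A} `{Enc E}.
Variables (f : X -> A -> E -> A).

(** [S] bounds the list and [Bd] every intermediate accumulator, so that all rounds have the same
    cost bound. *)
Lemma fold_loop_runs G c k :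
  (forall p : E * (X * A), tr G (code p) (c * (sz p).+1 ^ k)
     (code (p.2.1, f p.2.1 p.2.2 p.1))) ->
  forall x S Bd s a r0 r1 r2, sz s <= S ->
  (forall m, sz (foldl (f x) a (take m s)) <= Bd) ->
  sruns (fold_loop G) [:: tenc (code s) ++ tenc (code (x, a)) ++ r0; r1; r2; [::]]
    (size s * (22 * S + 20 + c * (S + (sz x + Bd)).+3 ^ k) + 3) tt
    [:: tenc (code (x, foldl (f x) a s)) ++ r0; r1; r2; [::]].
Proof.
move=> HG x S Bd; elim=> [|e s IH] a r0 r1 r2 sS sB.
  apply: (@sruns_rep_exit _ _ _ _ _ (1 + 1)); pops; exact: sruns_ret.
have sz1 : sz (e :: s) = (sz e + sz s).+1 by exact: sz_cons.
set Q := 22 * S + 20 + _.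
apply: (@sruns_leq _ _ _ (Q + (size s * Q + 3))); last by rewrite /=; lia.
apply: (@sruns_rep_next _ _ _ tt tt); last first.
  apply: (IH (f x a e)); first by lia.
  by move=> m; apply: (sB m.+1).
apply: (@sruns_leq _ _ _ (1 + ((7 * S + 5) + ((7 * S + 5) + ((4 * S + 3) + (1 +
   (c * (S + (sz x + Bd)).+3 ^ k + ((4 * S + 3) + 1)))))))); last by rewrite /Q; lia.
rewrite /= -!catA; pops.
have se : tsz (code e) <= S by rewrite -/(sz e); lia.
have ss : tsz (code s) <= S by rewrite -/(sz s); lia.
apply: sruns_bind.
  by apply: sruns_leq (@sruns_mvt false _ _ _ _) _; rewrite leq_add2r leq_mul2l se.
apply: sruns_bind.
  by apply: sruns_leq (@sruns_mvt true _ _ _ _) _; rewrite leq_add2r leq_mul2l ss.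
apply: sruns_bind.
  by apply: sruns_leq (@sruns_back false _ _ _ _ _) _; rewrite leq_add2r leq_mul2l se.
rewrite /=; pushs.
apply: sruns_bind.
  apply: (@sruns_leq _ _ _ (c * (sz (e, (x, a))).+1 ^ k)).
    have := HG (e, (x, a)) r0 r1; rewrite /= -!catA cat_cons -!catA; apply.
  apply: leq_cexp; have := sB 0; rewrite take0 /=.
  by rewrite !sz_pair -/(sz e) in se *; lia.
apply: sruns_bind.
  by apply: sruns_leq (@sruns_back true _ _ _ _ _) _; rewrite leq_add2r leq_mul2l ss.
exact: sruns_ret.
Qed.

Lemma size_le_sz (s : seq E) : size s <= sz s.
Proof. by elim: s => // e s IH; rewrite sz_cons /=; lia. Qed.

Lemma poly_foldl (l : X -> seq E) (i : X -> A) :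
  poly l -> poly i -> poly (fun p : X * A * E => f p.1.1 p.1.2 p.2) ->
  (exists2 q, pb q & forall x m, sz (foldl (f x) (i x) (take m (l x))) <= q (sz x)) ->
  poly (fun x => foldl (f x) (i x) (l x)).
Proof.
move=> Hl Hi Hf [q qb Hq].
have Hstep : poly (fun p : E * (X * A) => (p.2.1, f p.2.1 p.2.2 p.1)).
  apply: poly_pair; first exact/poly_fst/poly_snd/poly_id.
  have := poly_comp (poly_pair (poly_pair (poly_fst (poly_snd poly_id))
           (poly_snd (poly_snd poly_id))) (poly_fst poly_id)) Hf.
  exact.
have [F [cf [kf HF]]] : poly (fun x => (l x, (x, i x))).
  by do 2! apply: poly_pair => //; apply: poly_id.
case: Hstep => [G [c [k HG]]].
pose sF n := n + cf * n.+1 ^ kf.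
have Hp : poly (fun x => (x, foldl (f x) (i x) (l x))); last by have := poly_snd Hp; exact.
apply: (@poly_intro _ _ _ _ _ (F ;; pop 0 ;; fold_loop G)
  (fun n => cf * n.+1 ^ kf + (1 + (sF n * (22 * sF n + 20 +
     c * (sF n + (n + q n)).+3 ^ k) + 3)))); first by rewrite /sF; pbs.
move=> x r0 r1 r2; apply: sruns_bind; first exact: HF.
rewrite /= -catA; pops.
have sl : sz (l x) <= sF (sz x).
  by have := tr_size (HF x); rewrite -[tsz (code (l x, _))]/(sz _) sz_pair -/(sz _) /sF; lia.
apply: sruns_leq (@fold_loop_runs _ _ _ HG x (sF (sz x)) (q (sz x)) _ _ _ _ _ sl (Hq x)) _.
by rewrite leq_add2r leq_mul2r (leq_trans (size_le_sz _) sl) orbT.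
Qed.

End Fold.

Lemma poly_ext A B `{Enc A} `{Enc B} (f g : A -> B) : poly f -> f =1 g -> poly g.
Proof. by move=> [F [c [k HF]]] E; exists F, c, k => a; rewrite -E. Qed.

Lemma poly_size_exp A B `{Enc A} `{Enc B} (f : A -> B) : poly f ->
  exists c k, forall a, sz (f a) <= c * (sz a).+1 ^ k.
Proof.
by move=> /poly_size[q [c [k Hq]] Hf]; exists c, k => a; apply: leq_trans (Hf a) (Hq _).
Qed.

Lemma sz_take E `{Enc E} m (s : seq E) : sz (take m s) <= sz s.
Proof.
elim: s m => [|e s IH] [|m] //.
by rewrite [take _ _]/= !sz_cons ltnS leq_add2l.
Qed.

(** The allowed increment depends on the parameter and the entry but not on the accumulator, so the
    increments add up instead of compounding. *)
Lemma poly_foldl_add X A E `{Enc X} `{Enc A} `{Enc E} (f : X -> A -> E -> A)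
    (l : X -> seq E) (i : X -> A) :
  poly l -> poly i -> poly (fun p : X * A * E => f p.1.1 p.1.2 p.2) ->
  (exists c k, forall x a e, sz (f x a e) <= sz a + c * (sz x + sz e).+1 ^ k) ->
  poly (fun x => foldl (f x) (i x) (l x)).
Proof.
move=> Hl Hi Hf [c [k Hc]]; apply: poly_foldl => //.
have [ql pql Hql] := poly_size Hl; have [qi pqi Hqi] := poly_size Hi.
exists (fun n => qi n + ql n * (c * (n + ql n).+1 ^ k)); first by pbs.
move=> x m; set s := take m (l x).
have Hs : sz s <= ql (sz x) by apply: leq_trans (sz_take _ _) (Hql _).
apply: (@leq_trans (sz (i x) + size s * (c * (sz x + ql (sz x)).+1 ^ k))); last first.
  by apply: leq_add (Hqi _) _; rewrite leq_mul2r (leq_trans (size_le_sz _) Hs) orbT.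
elim: s (i x) Hs => [|e s IH] a Hs /=; first exact: leq_addr.
have Es : sz (e :: s) = (sz e + sz s).+1 by exact: sz_cons.
apply: leq_trans (IH _ _) _; first by lia.
rewrite mulSn addnA leq_add2r; apply: leq_trans (Hc _ _ _) _.
by rewrite leq_add2l; apply: leq_cexp; lia.
Qed.

(** * Booleans, numbers and lists in polynomial time *)

Lemma sz_nat (n : nat) : sz n = n.*2.+1.
Proof. by elim: n => // n IH; rewrite doubleS -IH /sz /tsz. Qed.

Lemma sz_bool (b : bool) : sz b <= 3.
Proof. by case: b. Qed.

Lemma poly_negb X `{Enc X} (b : X -> bool) : poly b -> poly (fun x => ~~ b x).
Proof. by move=> Hb; apply: (poly_if Hb); apply: poly_const. Qed.

Lemma poly_andb X `{Enc X} (b c : X -> bool) : poly b -> poly c -> poly (fun x => b x && c x).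
Proof. by move=> Hb Hc; apply: (poly_if Hb Hc); apply: poly_const. Qed.

Lemma poly_orb X `{Enc X} (b c : X -> bool) : poly b -> poly c -> poly (fun x => b x || c x).
Proof. by move=> Hb Hc; apply: (poly_if Hb _ Hc); apply: poly_const. Qed.

Lemma poly_addb X `{Enc X} (b c : X -> bool) : poly b -> poly c -> poly (fun x => b x (+) c x).
Proof.
move=> Hb Hc; have := poly_if Hb (poly_negb Hc) Hc; move/poly_ext; apply.
by move=> x /=; case: (b x).
Qed.

Lemma poly_S X `{Enc X} (n : X -> nat) : poly n -> poly (fun x => (n x).+1).
Proof.
move=> Hn; apply: (poly_comp (poly_pair (poly_const tt) Hn) (g := fun p => p.2.+1)).
exact: poly_cast.
Qed.

(** Numbers are coded in unary, exactly like lists of units; iterating [n] times thus becomes a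
    fold. *)
Lemma poly_units X `{Enc X} (n : X -> nat) : poly n -> poly (fun x => nseq (n x) tt).
Proof.
move=> Hn; apply: (poly_comp Hn (g := fun k => nseq k tt)).
by apply: poly_cast; elim=> //= k IH; congr Nd.
Qed.

Lemma poly_natmatch X `{Enc X} C `{Enc C} (n : X -> nat) (f : X -> C) (g : X -> nat -> C) :
  poly n -> poly f ->
  poly (fun p : nat * X => g p.2 p.1) -> poly (fun x => if n x is k.+1 then g x k else f x).
Proof.
move=> Hn Hf Hg.
have Hs : poly (fun s : seq unit => size s).
  by apply: poly_cast; elim=> //= -[] s IH; congr Nd.
have Hg' : poly (fun p : (unit * seq unit) * X => g p.2 (size p.1.2)).
  have := poly_comp (poly_pair (poly_comp (poly_snd (poly_fst (poly_id (A :=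
    (unit * seq unit) * X)))) Hs) (poly_snd poly_id)) Hg.
  exact.
have := poly_match (g := fun x _ t => g x (size t)) (poly_units Hn) Hf Hg'; move/poly_ext; apply.
by move=> x; case: (n x) => //= k; rewrite size_nseq.
Qed.

Lemma poly_pred X `{Enc X} (n : X -> nat) : poly n -> poly (fun x => (n x).-1).
Proof.
move=> Hn; have := poly_natmatch (g := fun (_ : X) k => k) Hn (poly_const 0) (poly_fst poly_id).
by move/poly_ext; apply=> x; case: (n x).
Qed.

Lemma poly_eq0 X `{Enc X} (n : X -> nat) : poly n -> poly (fun x => n x == 0).
Proof.
move=> Hn; have : poly (fun x => if n x is k.+1 then false else true).
  by apply: (poly_natmatch (g := fun _ _ => false) Hn); apply: poly_const.
by move/poly_ext; apply=> x; case: (n x).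
Qed.

Lemma poly_subn X `{Enc X} (m n : X -> nat) : poly m -> poly n -> poly (fun x => m x - n x).
Proof.
move=> Hm Hn; have : poly (fun x => foldl (fun k _ => k.-1) (m x) (nseq (n x) tt)).
  apply: poly_foldl_add => //; first exact: poly_units.
    exact/poly_pred/poly_snd/poly_fst/poly_id.
  by exists 0, 0 => x k e; rewrite !sz_nat; lia.
move/poly_ext; apply=> x; elim: (n x) (m x) => [|k IH] j /=; first by rewrite subn0.
by rewrite IH; lia.
Qed.

Lemma poly_addn X `{Enc X} (m n : X -> nat) : poly m -> poly n -> poly (fun x => m x + n x).
Proof.
move=> Hm Hn; have : poly (fun x => foldl (fun k _ => k.+1) (m x) (nseq (n x) tt)).
  apply: poly_foldl_add => //; first exact: poly_units.
    exact/poly_S/poly_snd/poly_fst/poly_id.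
  by exists 2, 0 => x k e; rewrite !sz_nat; lia.
move/poly_ext; apply=> x; elim: (n x) (m x) => [|k IH] j /=; first by rewrite addn0.
by rewrite IH addnS.
Qed.

Lemma poly_leq X `{Enc X} (m n : X -> nat) : poly m -> poly n -> poly (fun x => m x <= n x).
Proof. by move=> Hm Hn; apply: poly_eq0; apply: poly_subn. Qed.

Lemma poly_eqn X `{Enc X} (m n : X -> nat) : poly m -> poly n -> poly (fun x => m x == n x).
Proof.
move=> Hm Hn; have := poly_andb (poly_leq Hm Hn) (poly_leq Hn Hm).
by move/poly_ext; apply=> x; rewrite eqn_leq.
Qed.

Lemma poly_odd X `{Enc X} (n : X -> nat) : poly n -> poly (fun x => odd (n x)).
Proof.
move=> Hn; have : poly (fun x => foldl (fun b _ => ~~ b) false (nseq (n x) tt)).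
  apply: poly_foldl_add; [exact: poly_units | exact: poly_const | |].
    exact/poly_negb/poly_snd/poly_fst/poly_id.
  by exists 3, 0 => x b e; case: b.
move/poly_ext; apply=> x; rewrite -[odd _]addFb; elim: (n x) false => [|k IH] b /=.
  by rewrite addbF.
by rewrite IH addNb -addbN.
Qed.

Lemma poly_catrev X E `{Enc X} `{Enc E} (l s : X -> seq E) :
  poly l -> poly s -> poly (fun x => catrev (l x) (s x)).
Proof.
move=> Hl Hs; have : poly (fun x => foldl (fun t e => e :: t) (s x) (l x)).
  apply: poly_foldl_add => //.
    apply: poly_cons; first exact: poly_snd poly_id.
    exact/poly_snd/poly_fst/poly_id.
  by exists 1, 1 => x t e; rewrite sz_cons; lia.
by move/poly_ext; apply=> x; elim: (l x) (s x) => [|e t IH] u /=.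
Qed.

Lemma poly_rev X E `{Enc X} `{Enc E} (l : X -> seq E) : poly l -> poly (fun x => rev (l x)).
Proof. by move=> Hl; apply: (poly_catrev Hl (poly_const _)). Qed.

Lemma poly_cat X E `{Enc X} `{Enc E} (l s : X -> seq E) :
  poly l -> poly s -> poly (fun x => l x ++ s x).
Proof.
move=> Hl Hs; have := poly_catrev (poly_rev Hl) Hs.
by move/poly_ext; apply=> x; rewrite catrevE revK.
Qed.

Lemma poly_size_seq X E `{Enc X} `{Enc E} (l : X -> seq E) :
  poly l -> poly (fun x => size (l x)).
Proof.
move=> Hl; have : poly (fun x => foldl (fun n _ => n.+1) 0 (l x)).
  apply: poly_foldl_add => //; first exact: poly_const.
    exact/poly_S/poly_snd/poly_fst/poly_id.
  by exists 2, 0 => x k e; rewrite !sz_nat; lia.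
move/poly_ext; apply=> x; rewrite -[RHS]add0n.
by elim: (l x) 0 => [|e s IH] n /=; rewrite ?addn0 // IH addSnnS.
Qed.

Lemma poly_map X E F `{Enc X} `{Enc E} `{Enc F} (l : X -> seq E) (f : X -> E -> F) : poly l ->
  poly (fun p : X * E => f p.1 p.2) -> poly (fun x => map (f x) (l x)).
Proof.
move=> Hl Hf; have : poly (fun x => foldl (fun t e => f x e :: t) [::] (l x)).
  apply: (poly_foldl_add (f := fun x t e => f x e :: t)) => //; first exact: poly_const.
    apply: poly_cons; last exact/poly_snd/poly_fst/poly_id.
    have := poly_comp (poly_pair (poly_fst (poly_fst poly_id)) (poly_snd poly_id)) Hf.
    exact.
  have [c [k Hc]] := poly_size_exp Hf; exists (c * 2 ^ k + 1), k => x t e.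
  rewrite sz_cons -addSn addnC leq_add2l.
  have E1 : sz (x, e) = (sz x + sz e).+1 by exact: sz_pair.
  have := Hc (x, e); rewrite E1 /= mulnDl mul1n -mulnA -expnMn => h.
  have h2 : 0 < (sz x + sz e).+1 ^ k by rewrite expn_gt0.
  have h3 : c * (sz x + sz e).+2 ^ k <= c * (2 * (sz x + sz e).+1) ^ k.
    by rewrite leq_mul2l leq_exp2l_base ?orbT //; lia.
  lia.
move/poly_rev/poly_ext; apply=> x.
suff G t : rev (foldl (fun t e => f x e :: t) t (l x)) = rev t ++ map (f x) (l x).
  exact: (G [::]).
elim: (l x) t => [|e s IH] t /=; first by rewrite cats0.
by rewrite IH rev_cons cat_rcons.
Qed.

Lemma poly_filter X E `{Enc X} `{Enc E} (l : X -> seq E) (P : X -> E -> bool) : poly l ->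
  poly (fun p : X * E => P p.1 p.2) -> poly (fun x => filter (P x) (l x)).
Proof.
move=> Hl HP; have : poly (fun x => foldl (fun t e => if P x e then e :: t else t) [::] (l x)).
  apply: (poly_foldl_add (f := fun x t e => if P x e then e :: t else t)) => //.
  - exact: poly_const.
  - apply: poly_if; last exact/poly_snd/poly_fst/poly_id.
      have := poly_comp (poly_pair (poly_fst (poly_fst poly_id)) (poly_snd poly_id)) HP.
      exact.
    apply: poly_cons; [exact/poly_snd/poly_id | exact/poly_snd/poly_fst/poly_id].
  - by exists 1, 1 => x t e; case: ifP; rewrite ?sz_cons; lia.
move/poly_rev/poly_ext; apply=> x.
suff G t : rev (foldl (fun t e => if P x e then e :: t else t) t (l x)) =
    rev t ++ filter (P x) (l x).
  exact: (G [::]).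
elim: (l x) t => [|e s IH] t /=; first by rewrite cats0.
by rewrite IH; case: ifP => _ //; rewrite rev_cons cat_rcons.
Qed.

Lemma poly_has X E `{Enc X} `{Enc E} (l : X -> seq E) (P : X -> E -> bool) : poly l ->
  poly (fun p : X * E => P p.1 p.2) -> poly (fun x => has (P x) (l x)).
Proof.
move=> Hl HP; have := poly_negb (poly_eq0 (poly_size_seq (poly_filter Hl HP))).
by move/poly_ext; apply=> x; rewrite size_filter has_count lt0n.
Qed.

Lemma poly_all X E `{Enc X} `{Enc E} (l : X -> seq E) (P : X -> E -> bool) : poly l ->
  poly (fun p : X * E => P p.1 p.2) -> poly (fun x => all (P x) (l x)).
Proof.
move=> Hl HP; have := poly_negb (poly_has Hl (P := fun x e => ~~ P x e) (poly_negb HP)).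
by move/poly_ext; apply=> x; rewrite has_predC negbK.
Qed.

Lemma poly_count X E `{Enc X} `{Enc E} (l : X -> seq E) (P : X -> E -> bool) : poly l ->
  poly (fun p : X * E => P p.1 p.2) -> poly (fun x => count (P x) (l x)).
Proof.
move=> Hl HP; have := poly_size_seq (poly_filter Hl HP).
by move/poly_ext; apply=> x; rewrite size_filter.
Qed.

Lemma poly_head X E `{Enc X} `{Enc E} (d : X -> E) (l : X -> seq E) :
  poly d -> poly l -> poly (fun x => head (d x) (l x)).
Proof.
move=> Hd Hl; have : poly (fun x => if l x is h :: t then h else d x).
  by apply: (poly_match (g := fun _ h _ => h) Hl Hd); apply/poly_fst/poly_fst/poly_id.
by move/poly_ext; apply=> x; case: (l x).
Qed.

Lemma poly_behead X E `{Enc X} `{Enc E} (l : X -> seq E) :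
  poly l -> poly (fun x => behead (l x)).
Proof.
move=> Hl; have : poly (fun x => if l x is h :: t then t else [::]).
  apply: (poly_match (g := fun _ _ t => t) Hl); first exact: poly_const.
  exact/poly_snd/poly_fst/poly_id.
by move/poly_ext; apply=> x; case: (l x).
Qed.

Lemma poly_nilp X E `{Enc X} `{Enc E} (l : X -> seq E) : poly l -> poly (fun x => nilp (l x)).
Proof. by move=> Hl; apply: poly_eq0; apply: poly_size_seq. Qed.

Lemma sz_behead E `{Enc E} (s : seq E) : sz (behead s) <= sz s.
Proof. by case: s => //= e s; rewrite sz_cons; lia. Qed.

Lemma poly_drop X E `{Enc X} `{Enc E} (n : X -> nat) (l : X -> seq E) :
  poly n -> poly l -> poly (fun x => drop (n x) (l x)).
Proof.
move=> Hn Hl; have : poly (fun x => foldl (fun s _ => behead s) (l x) (nseq (n x) tt)).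
  apply: poly_foldl_add => //; first exact: poly_units.
    exact/poly_behead/poly_snd/poly_fst/poly_id.
  by exists 0, 0 => x s e; rewrite addn0 sz_behead.
move/poly_ext; apply=> x; by elim: (n x) (l x) => [|k IH] [|e s] //=; rewrite IH.
Qed.

Lemma poly_nth X E `{Enc X} `{Enc E} (d : X -> E) (l : X -> seq E) (n : X -> nat) :
  poly d -> poly l -> poly n -> poly (fun x => nth (d x) (l x) (n x)).
Proof.
move=> Hd Hl Hn; have := poly_head Hd (poly_drop Hn Hl).
by move/poly_ext; apply=> x; rewrite -nth0 nth_drop addn0.
Qed.

Lemma poly_take1 X E `{Enc X} `{Enc E} (l : X -> seq E) :
  poly l -> poly (fun x => take 1 (l x)).
Proof.
move=> Hl; have : poly (fun x => if l x is h :: t then [:: h] else [::]).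
  apply: (poly_match (g := fun _ h _ => [:: h]) Hl); first exact: poly_const.
  by apply: poly_cons; [exact/poly_fst/poly_fst/poly_id | exact: poly_const].
by move/poly_ext; apply=> x; case: (l x) => //= e s; rewrite take0.
Qed.

Lemma sz_cat E `{Enc E} (s t : seq E) : sz (s ++ t) <= sz s + sz t.
Proof. by elim: s => [|e s IH] /=; rewrite ?sz_cons; lia. Qed.

Lemma poly_flatten X E `{Enc X} `{Enc E} (l : X -> seq (seq E)) :
  poly l -> poly (fun x => flatten (l x)).
Proof.
move=> Hl; have : poly (fun x => foldl (fun t e => t ++ e) [::] (l x)).
  apply: poly_foldl_add => //; first exact: poly_const.
    apply: poly_cat; [exact/poly_snd/poly_fst/poly_id | exact/poly_snd/poly_id].
  by exists 1, 1 => x t e; apply: leq_trans (sz_cat _ _) _; lia.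
move/poly_ext; apply=> x; rewrite -[RHS]cat0s.
by elim: (l x) [::] => [|e s IH] t /=; rewrite ?cats0 // IH catA.
Qed.

Lemma poly_find X E `{Enc X} `{Enc E} (l : X -> seq E) (P : X -> E -> bool) : poly l ->
  poly (fun p : X * E => P p.1 p.2) -> poly (fun x => find (P x) (l x)).
Proof.
move=> Hl HP.
have HP' : poly (fun p : X * (bool * nat) * E => P p.1.1 p.2).
  have := poly_comp (poly_pair (poly_fst (poly_fst poly_id)) (poly_snd poly_id)) HP.
  exact.
have H1 : poly (fun p : X * (bool * nat) * E => p.1.2.1).
  exact/poly_fst/poly_snd/poly_fst/poly_id.
have H2 : poly (fun p : X * (bool * nat) * E => p.1.2.2).
  exact/poly_snd/poly_snd/poly_fst/poly_id.
have : poly (fun x => (foldl (fun a e => (a.1 || P x e, if a.1 || P x e then a.2 else a.2.+1))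
    (false, 0) (l x)).2).
  apply: poly_snd.
  apply: (poly_foldl_add (f := fun x a e => (a.1 || P x e, if a.1 || P x e then a.2 else a.2.+1)))
    => //; first exact: poly_const.
    by apply: poly_pair; [apply: poly_orb | apply: poly_if => //; [apply: poly_orb | apply: poly_S]].
  exists 6, 0 => x [b n] e; rewrite !sz_pair !sz_nat /=.
  by have := sz_bool (b || P x e); case: ifP; lia.
move/poly_ext; apply=> x.
suff G b n : (foldl (fun a e => (a.1 || P x e, if a.1 || P x e then a.2 else a.2.+1))
    (b, n) (l x)).2
    = if b then n else n + find (P x) (l x) by rewrite G.
elim: (l x) b n => [|e s IH] b n /=; first by case: b; rewrite ?addn0.
by rewrite IH; case: b => //=; case: (P x e); rewrite ?addn0 ?addnS.
Qed.

Lemma poly_mem X `{Enc X} (n : X -> nat) (l : X -> seq nat) :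
  poly n -> poly l -> poly (fun x => n x \in l x).
Proof.
move=> Hn Hl; have := poly_has (P := fun x y => y == n x) Hl.
have HP : poly (fun p : X * nat => p.2 == n p.1).
  by apply: poly_eqn; [exact/poly_snd/poly_id | exact: (poly_comp (poly_fst poly_id) Hn)].
move/(_ HP)/poly_ext; apply=> x; by rewrite has_pred1.
Qed.

Lemma poly_index X `{Enc X} (n : X -> nat) (l : X -> seq nat) :
  poly n -> poly l -> poly (fun x => index (n x) (l x)).
Proof.
move=> Hn Hl; have := poly_find (P := fun x y => y == n x) Hl; apply.
by apply: poly_eqn; [exact/poly_snd/poly_id | exact: (poly_comp (poly_fst poly_id) Hn)].
Qed.

Lemma sz_seqnat N (s : seq nat) : all (fun i => i < N) s -> sz s <= size s * N.*2.+2 + 1.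
Proof.
elim: s => //= i s IH /andP[iN /IH]; rewrite sz_cons sz_nat; lia.
Qed.

(** The new entry is as large as the accumulator is long, so [poly_foldl_add] does not apply. The
    accumulator is bounded directly, as a list of at most [n x] numbers below [n x]. *)
Lemma poly_iota X `{Enc X} (n : X -> nat) : poly n -> poly (fun x => iota 0 (n x)).
Proof.
move=> Hn.
have E m : foldl (fun s (_ : unit) => s ++ [:: size s]) [::] (nseq m tt) = iota 0 m.
  elim: m => // m IH; rewrite -addn1 nseqD foldl_cat IH /= size_iota.
  by rewrite iotaD.
have : poly (fun x => foldl (fun s _ => s ++ [:: size s]) [::] (nseq (n x) tt)).
  apply: poly_foldl; [exact: poly_units | exact: poly_const | |].
    apply: poly_cat; first exact/poly_snd/poly_fst/poly_id.
    apply: poly_cons; last exact: poly_const.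
    exact/poly_size_seq/poly_snd/poly_fst/poly_id.
  have [q pq Hq] := poly_size Hn.
  exists (fun m => q m * (2 * q m + 2) + 1); first by pbs.
  move=> x m; have -> : take m (nseq (n x) tt) = nseq (minn m (n x)) tt.
    by elim: m (n x) => [|m IH] [|k] //=; rewrite IH minnSS.
  rewrite E; apply: leq_trans (@sz_seqnat (n x) _ _) _.
    by apply/allP=> i; rewrite mem_iota; lia.
  rewrite size_iota; have := Hq x; rewrite sz_nat => h.
  by rewrite leq_add2r; apply: leq_mul; lia.
by move/poly_ext; apply=> x; rewrite E.
Qed.

(** * From polynomial-time functions to Turing machines *)

Definition pour (i : nat) (k : bool -> frag unit) : frag unit :=
  rep (A := unit) (B := unit) tt (fun _ => bind (pop i) (fun y =>
    if y is Some b then k b ;; ret (inl tt) else ret (inr tt))).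

(** The code of a list is built on the stack from its final leaf upwards, which takes the bits in
    reverse; pouring the word onto stack 1 provides that order. *)
Definition rawin : frag unit :=
  pour 0 (push 1) ;; push 0 false ;;
  pour 1 (fun b => pushw (true :: tenc (code b))).

(** The bit [true] is coded by a node with two leaves, whence the two extra pops; the word comes out
    reversed and is poured back. *)
Definition rawout : frag unit :=
  rep (A := unit) (B := unit) tt (fun _ => bind (pop 0) (fun y =>
    if y == Some true then bind (pop 0) (fun b =>
      push 1 (b == Some true) ;;
      (if b == Some true then pop 0 ;; pop 0 ;; ret (inl tt) else ret (inl tt)))
    else ret (inr tt))) ;;
  pour 1 (push 0).

Lemma sruns_pour01 w x :
  sruns (pour 0 (push 1)) [:: w; x; [::]; [::]] (3 * size w + 3) tt
    [:: [::]; catrev w x; [::]; [::]].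
Proof.
elim: w x => [|b w IH] x.
  by apply: (@sruns_rep_exit _ _ _ _ _ (1 + 1)); popn; apply: sruns_ret.
apply: (@sruns_leq _ _ _ ((1 + (1 + 1)) + (3 * size w + 3))); last by rewrite /=; lia.
apply: (@sruns_rep_next _ _ _ tt tt); last exact: (IH (b :: x)).
by pops; pushs; apply: sruns_ret.
Qed.

Lemma sruns_pour10 w x :
  sruns (pour 1 (push 0)) [:: x; w; [::]; [::]] (3 * size w + 3) tt
    [:: catrev w x; [::]; [::]; [::]].
Proof.
elim: w x => [|b w IH] x.
  by apply: (@sruns_rep_exit _ _ _ _ _ (1 + 1)); popn; apply: sruns_ret.
apply: (@sruns_leq _ _ _ ((1 + (1 + 1)) + (3 * size w + 3))); last by rewrite /=; lia.
apply: (@sruns_rep_next _ _ _ tt tt); last exact: (IH (b :: x)).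
by pops; pushs; apply: sruns_ret.
Qed.

Lemma sruns_rawin (w : seq bool) :
  sruns rawin [:: w; [::]; [::]; [::]] (10 * size w + 7) tt
    [:: tenc (code w); [::]; [::]; [::]].
Proof.
apply: (@sruns_leq _ _ _ ((3 * size w + 3) + (1 + (7 * size w + 3)))); last by lia.
apply: sruns_bind; first exact: sruns_pour01.
pushs.
have Hp : forall v x : seq bool, sruns (pour 1 (fun b => pushw (true :: tenc (code b))))
    [:: tenc (code x); v; [::]; [::]] (7 * size v + 3) tt
    [:: tenc (code (catrev v x)); [::]; [::]; [::]].
  elim=> [|b v IH] x.
    by apply: (@sruns_rep_exit _ _ _ _ _ (1 + 1)); popn; apply: sruns_ret.
  apply: (@sruns_leq _ _ _ ((1 + (5 + 1)) + (7 * size v + 3))); last by rewrite /=; lia.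
  apply: (@sruns_rep_next _ _ _ tt tt); last exact: (IH (b :: x)).
  pops; apply: sruns_bind; last exact: sruns_ret.
  apply: sruns_leq (sruns_pushw (true :: tenc (code b)) _ _ _ _) _.
  by rewrite /= !ltnS; apply: sz_bool.
have := Hp (rev w) [::]; rewrite size_rev.
by have -> : catrev (rev w) [::] = w by rewrite -[RHS]revK.
Qed.

Lemma sruns_rawout (w : seq bool) :
  sruns rawout [:: tenc (code w); [::]; [::]; [::]] (9 * size w + 6) tt
    [:: w; [::]; [::]; [::]].
Proof.
apply: (@sruns_leq _ _ _ ((6 * size w + 3) + (3 * size (rev w) + 3))); last first.
  by rewrite size_rev; lia.
apply: (@sruns_bind _ _ _ _ _ _ tt [:: [::]; rev w; [::]; [::]]); last first.
  have := sruns_pour10 (rev w) [::].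
  by have -> : catrev (rev w) [::] = w by rewrite -[RHS]revK.
have Hp : forall x, sruns (rep (A := unit) (B := unit) tt (fun _ => bind (pop 0) (fun y =>
    if y == Some true then bind (pop 0) (fun b =>
      push 1 (b == Some true) ;;
      (if b == Some true then pop 0 ;; pop 0 ;; ret (inl tt) else ret (inl tt)))
    else ret (inr tt)))) [:: tenc (code w); x; [::]; [::]] (6 * size w + 3) tt
    [:: [::]; catrev w x; [::]; [::]]; last exact: Hp.
elim: w => [|b w IH] x.
  apply: (@sruns_rep_exit _ _ _ _ _ (1 + 1)); pops; exact: sruns_ret.
apply: (@sruns_leq _ _ _ (6 + (6 * size w + 3))); last by rewrite /=; lia.
apply: (@sruns_rep_next _ _ _ tt tt); last exact: (IH (b :: x)).
case: b => /=.
  apply: (@sruns_leq _ _ _ (1 + (1 + (1 + (1 + (1 + 1)))))); last by [].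
  by do 2! pops; pushs; do 2! pops; apply: sruns_ret.
apply: (@sruns_leq _ _ _ (1 + (1 + (1 + 1)))); last by [].
by do 2! pops; pushs; apply: sruns_ret.
Qed.

Lemma tp_single w : tp [:: w; [::]; [::]; [::]] = tl (None :: map Some w).
Proof.
rewrite /tp !lay_cons lay_nil /=.
rewrite -[in RHS]nth_rcons_None -[in RHS]nth_rcons_None -[in RHS]nth_rcons_None.
by rewrite -!cats1 -!catA.
Qed.

Theorem poly_halts (f : seq bool -> seq bool) : poly f ->
  exists M c k, forall w, halts_within M w (c * (size w).+1 ^ k) (f w).
Proof.
move=> [F [c [k HF]]].
pose core := rawin ;; F ;; rawout.
(* The input starts on cell 0, where the stack layout needs a blank: [shiftR None] makes room for it
   and [skipL] returns to it. The last [skipR] puts the head on cell 1, where the output begins. *)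
pose M := shiftR None ;; skipL ;; core ;; skipR.
have szw (w : seq bool) : sz w <= 4 * size w + 1.
  by elim: w => // b w IH; rewrite sz_cons /=; have := sz_bool b; lia.
have szw' (w : seq bool) : size w <= sz w by exact: size_le_sz.
pose z n := c * (4 * n + 1).+1 ^ k.
pose q n := (10 * n + 7) + (z n + (9 * ((4 * n + 1) + z n) + 6)).
pose T n := (2 * n.+1 + (2 * n.+2 + (30 * q n * (n + 4 + q n) + 2).+1).+1).+1.
have [cT [kT HT]] : pb T by rewrite /T /q /z; pbs.
exists (tm_of_frag M), cT, kT => w; rewrite /halts_within.
have tw : tot [:: w; [::]; [::]; [::]] = size w + 4.
  by rewrite /tot !lay_cons lay_nil /= size_cat /= size_map; lia.
have Hcore : sruns core [:: w; [::]; [::]; [::]] (q (size w)) tt [:: f w; [::]; [::]; [::]].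
  have zw : c * (sz w).+1 ^ k <= z (size w) by apply: leq_cexp.
  have fw : size (f w) <= (4 * size w + 1) + z (size w).
    apply: leq_trans (szw' _) _; apply: leq_trans (tr_size (HF w)) _.
    by apply: leq_add zw; apply: szw.
  apply: sruns_bind; first exact: sruns_rawin.
  apply: sruns_bind.
    apply: sruns_leq zw; have := HF w [::] [::] [::]; rewrite !cats0; exact.
  by apply: sruns_leq (sruns_rawout _) _; lia.
have : runs M (tl (map Some w)) 0 (T (size w)) tt (tl (None :: map Some (f w))) 1.
  apply: runs_bind.
    rewrite -nth_rcons_None -cats1; exact: (@runs_shiftR None [::] w [::]).
  rewrite cats0; apply: runs_bind.
    by have := @runs_skipL [::] w [::] (size w).+1 0; rewrite cats0; apply.
  case: Hcore => _ _; rewrite !tp_single tw => R; apply: runs_bind; first exact: R.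
  apply: (@runs_leq _ _ _ _ 2) => //.
  exact: (@runs_skipR [::] [::] _ 0 1).
move=> /tm_of_frag_runs[m [mT [s [E1 E2]]]]; exists m; split; first exact: leq_trans mT (HT _).
exists (Cfg (tm_of_frag M) s (tl (None :: map Some (f w))) 1); split; first exact: E1.
split=> //; split=> [i Hi|] /=.
  by rewrite (nth_map false).
by rewrite nth_default // size_map.
Qed.

(** * The algorithm *)

(* [l] is [code_zx D], vertices are numbered by [vidx], and all data are read off [l]. *)
Definition nn (l : seq nat) := nth 0 l 0.
Definition mm (l : seq nat) := nth 0 l (nn l + nn l + nn l).+1.
Definition NN (l : seq nat) := nn l + (mm l + mm l).
(** The header, three entries per node and the wire count fill the indices up to [3 * nn l + 1]. The
    end [b] of wire [k] has number [j = nn l + 2k + b], and its entry lies [2k + b] places further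
    on. *)
Definition ep (l : seq nat) (j : nat) := nth 0 l (nn l + nn l + j).+2.
Definition isP (l : seq nat) (i : nat) := (i < nn l) && (0 < nth 0 l (i + i + i).+2).
Definition isodd (l : seq nat) (i : nat) := (i < nn l) && (0 < nth 0 l (i + i + i).+3).
Definition valid (l : seq nat) (j : nat) := (j < nn l) || (ep l j <= 1).
Definition isout (l : seq nat) (j : nat) := (nn l <= j) && (ep l j == 1).
Definition att (l : seq nat) (x j : nat) :=
  if x < nn l then ep l j == x.+2 else (x == j) && (ep l j <= 1).
Definition adj (l : seq nat) (x y : nat) :=
  has (fun k => att l x (nn l + (k + k)) && att l y (nn l + (k + k)).+1
             || att l x (nn l + (k + k)).+1 && att l y (nn l + (k + k))) (iota 0 (mm l))
  || (x == y) && isodd l x.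
Definition vs (l : seq nat) := filter (valid l) (iota 0 (NN l)).

(** Filtering [iota] keeps the sum a list without repetitions, so its length stays bounded under
    iteration. *)
Definition xorl (l C D : seq nat) :=
  [seq i <- iota 0 (NN l) | (i \in C) (+) (i \in D)].
Definition oddat (l : seq nat) (w : nat) (C : seq nat) := odd (count (adj l w) C).
(* Generators of the subspace cut out of the span of [gens] by the parity
   condition at [w]: the first odd generator serves as pivot. *)
Definition elim_row (l : seq nat) (gens : seq (seq nat)) (w : nat) : seq (seq nat) :=
  [seq C <- gens | ~~ oddat l w C] ++
  [seq xorl l (head [::] [seq C <- gens | oddat l w C]) C
     | C <- behead [seq C <- gens | oddat l w C]].
Definition gens0 (l L : seq nat) : seq (seq nat) :=
  [seq [:: a] | a <- [seq a <- vs l | (a \in L) || isP l a]].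
Definition rows (l L : seq nat) (u : nat) :=
  [seq w <- vs l | (w \notin L) && (w != u)].
(** The equation at [u] is the inhomogeneous one. It is not imposed but tested at the end: parity is
    linear, so the remaining span contains a set odd at [u] iff one of its generators is odd
    there. *)
Definition solve (l L : seq nat) (u : nat) : seq (seq nat) :=
  [seq C <- foldl (elim_row l) (gens0 l L) (rows l L u) | oddat l u C].

(** Neighbours outside [L] will lie below [v], where condition (iii) requires a corrector; a single
    exception can be absorbed by [f]. *)
Definition bad (l L : seq nat) (v : nat) :=
  [seq u <- vs l | (u \notin L) && ((u != v) && (adj l v u && nilp (solve l L u)))].
(** For a spider: condition (i) at adjacent outputs, then condition (ii), which is void once a
    neighbour is in [L], then condition (iii). Condition (i) at an input is tested when the input
    itself is added; asking at the spider that the input be outside [L] would not be monotone in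
    [L]. *)
Definition addable (l L : seq nat) (v : nat) :=
  if v < nn l then
    all (fun u => ~~ (isout l u && (adj l v u && (u \notin L)))) (vs l) &&
    ((has (fun u => (u \in L) && adj l v u) (vs l) || ~~ nilp (solve l L v)) &&
     (size (bad l L v) <= 1))
  else isout l v || all (fun u => ~~ ((u < nn l) && (adj l v u && (u \notin L)))) (vs l).
(* The head of [L] is the vertex added last, hence the lowest one. *)
Definition gstep (l L : seq nat) :=
  take 1 [seq v <- vs l | (v \notin L) && addable l L v] ++ L.
Definition greedy (l : seq nat) :=
  foldl (fun L _ => gstep l L) [::] (iota 0 (NN l)).

(** The tail behind [v] is both the set of vertices above [v] in the final order and the value of
    [L] when [v] was added. *)
Definition after (L : seq nat) (v : nat) := behead (drop (index v L) L).
Definition pairs (L : seq nat) : seq (nat * nat) :=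
  flatten [seq [seq (x, y) | y <- drop (index x L) L] | x <- L].
(** If no neighbour needs the exemption, any vertex may serve as value; the default is [v]
    itself. *)
Definition fval (l L : seq nat) (v : nat) := head v (bad l (after L v) v).
(* More sets than needed: every corrector that exists for any [u], adjacent or not. *)
Definition csets (l L : seq nat) : seq (seq nat) :=
  flatten [seq flatten [seq take 1 (solve l (after L v) u) | u <- vs l] | v <- iota 0 (nn l)].
Definition answer (l L : seq nat) : seq nat :=
  if all (fun v => v \in L) (vs l) then
    1 :: size (pairs L) :: flatten [seq [:: p.1; p.2] | p <- pairs L]
      ++ [seq fval l L v | v <- iota 0 (nn l)]
      ++ size (csets l L) :: flatten [seq size s :: s | s <- csets l L]
  else [:: 0].

Definition decode_step (a : nat * seq nat) (b : bool) : nat * seq nat :=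
  if b then (a.1.+1, a.2) else (0, a.1 :: a.2).
Definition decode (w : seq bool) : seq nat := rev (foldl decode_step (0, [::]) w).2.
Definition pfflow_alg (w : seq bool) : seq bool :=
  enc_nats (answer (decode w) (greedy (decode w))).

(** * The algorithm runs in polynomial time *)

Lemma poly_app2 X A B C `{Enc X} `{Enc A} `{Enc B} `{Enc C} (f : A -> B -> C) :
  poly (fun p : A * B => f p.1 p.2) ->
  forall (a : X -> A) (b : X -> B), poly a -> poly b -> poly (fun x => f (a x) (b x)).
Proof. by move=> Hf a b Ha Hb; apply: (poly_comp (poly_pair Ha Hb) Hf). Qed.

Lemma poly_app3 X A B C D `{Enc X} `{Enc A} `{Enc B} `{Enc C} `{Enc D} (f : A -> B -> C -> D) :
  poly (fun p : A * B * C => f p.1.1 p.1.2 p.2) ->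
  forall (a : X -> A) (b : X -> B) (c : X -> C), poly a -> poly b -> poly c ->
  poly (fun x => f (a x) (b x) (c x)).
Proof. by move=> Hf a b c Ha Hb Hc; apply: (poly_comp (poly_pair (poly_pair Ha Hb) Hc) Hf). Qed.

Ltac poly_core := lazymatch goal with
  | |- poly (fun x => x) => apply: poly_id
  | |- poly (fun _ => ?c) => apply: poly_const
  | |- poly (fun x => andb (@?a x) (@?b x)) => apply: poly_andb
  | |- poly (fun x => orb (@?a x) (@?b x)) => apply: poly_orb
  | |- poly (fun x => negb (@?a x)) => apply: poly_negb
  | |- poly (fun x => addb (@?a x) (@?b x)) => apply: poly_addb
  | |- poly (fun x => nilp (@?a x)) => apply: poly_nilp
  | |- poly (fun x => in_mem (@?a x) (@?b x)) => apply: poly_mem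
  | |- poly (fun x => leq (@?a x) (@?b x)) => apply: poly_leq
  | |- poly (fun x => eq_op (@?a x) (@?b x)) => apply: poly_eqn
  | |- poly (fun x => odd (@?a x)) => apply: poly_odd
  | |- poly (fun x => S (@?a x)) => apply: poly_S
  | |- poly (fun x => addn (@?a x) (@?b x)) => apply: poly_addn
  | |- poly (fun x => nth (@?d x) (@?a x) (@?b x)) => apply: poly_nth
  | |- poly (fun x => head (@?d x) (@?a x)) => apply: poly_head
  | |- poly (fun x => behead (@?a x)) => apply: poly_behead
  | |- poly (fun x => take 1 (@?a x)) => apply: poly_take1
  | |- poly (fun x => cons (@?a x) (@?b x)) => apply: poly_cons
  | |- poly (fun x => drop (@?a x) (@?b x)) => apply: poly_drop
  | |- poly (fun x => index (@?a x) (@?b x)) => apply: poly_index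
  | |- poly (fun x => size (@?a x)) => apply: poly_size_seq
  | |- poly (fun x => count (@?P x) (@?a x)) => apply: poly_count
  | |- poly (fun x => has (@?P x) (@?a x)) => apply: poly_has
  | |- poly (fun x => all (@?P x) (@?a x)) => apply: poly_all
  | |- poly (fun x => filter (@?P x) (@?a x)) => apply: poly_filter
  | |- poly (fun x => map (@?P x) (@?a x)) => apply: poly_map
  | |- poly (fun x => flatten (@?a x)) => apply: poly_flatten
  | |- poly (fun x => cat (@?a x) (@?b x)) => apply: poly_cat
  | |- poly (fun x => iota 0 (@?a x)) => apply: poly_iota
  | |- poly (fun x => (@?a x, @?b x)) => apply: poly_pair
  | |- poly (fun x => fst (@?a x)) => apply: poly_fst
  | |- poly (fun x => snd (@?a x)) => apply: poly_snd
  end.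
Ltac poly_def := fail.
(* Unification eta-reduces, which the syntactic patterns above do not see through. *)
Ltac poly_eta := lazymatch goal with
  | |- poly (fun x => _) => idtac
  | |- @poly ?A ?B ?EA ?EB ?f => change (@poly A B EA EB (fun x => f x))
  end.
Ltac polys := repeat (cbv beta; poly_eta; first [poly_core | poly_def | apply: poly_if]).

Lemma poly_nn X `{Enc X} (l : X -> seq nat) : poly l -> poly (fun x => nn (l x)).
Proof. by move=> Hl; apply: poly_nth => //; apply: poly_const. Qed.
Ltac poly_def1 := lazymatch goal with
  | |- poly (fun x => nn (@?a x)) => apply: poly_nn
  end.
Ltac poly_def ::= poly_def1.

Lemma poly_mm0 : poly mm.
Proof. by rewrite /mm; polys. Qed.
Lemma poly_mm X `{Enc X} (l : X -> seq nat) : poly l -> poly (fun x => mm (l x)).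
Proof. by move=> Hl; apply: (poly_comp Hl poly_mm0). Qed.
Ltac poly_def2 := lazymatch goal with
  | |- poly (fun x => mm (@?a x)) => apply: poly_mm
  | |- _ => poly_def1
  end.
Ltac poly_def ::= poly_def2.

Lemma poly_NN0 : poly NN.
Proof. by rewrite /NN; polys. Qed.
Lemma poly_NN X `{Enc X} (l : X -> seq nat) : poly l -> poly (fun x => NN (l x)).
Proof. by move=> Hl; apply: (poly_comp Hl poly_NN0). Qed.

Lemma poly_ep0 : poly (fun p => ep p.1 p.2).
Proof. by rewrite /ep; polys. Qed.
Ltac poly_def3 := lazymatch goal with
  | |- poly (fun x => NN (@?a x)) => apply: poly_NN
  | |- poly (fun x => ep (@?a x) (@?b x)) => apply: (poly_app2 poly_ep0)
  | |- _ => poly_def2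
  end.
Ltac poly_def ::= poly_def3.

Lemma poly_isP0 : poly (fun p => isP p.1 p.2).
Proof. by rewrite /isP; polys. Qed.
Lemma poly_isodd0 : poly (fun p => isodd p.1 p.2).
Proof. by rewrite /isodd; polys. Qed.
Lemma poly_valid0 : poly (fun p => valid p.1 p.2).
Proof. by rewrite /valid; polys. Qed.
Lemma poly_isout0 : poly (fun p => isout p.1 p.2).
Proof. by rewrite /isout; polys. Qed.
Lemma poly_att0 : poly (fun p => att p.1.1 p.1.2 p.2).
Proof. by rewrite /att; polys. Qed.
Ltac poly_def4 := lazymatch goal with
  | |- poly (fun x => isP (@?a x) (@?b x)) => apply: (poly_app2 poly_isP0)
  | |- poly (fun x => isodd (@?a x) (@?b x)) => apply: (poly_app2 poly_isodd0)
  | |- poly (fun x => valid (@?a x) (@?b x)) => apply: (poly_app2 poly_valid0)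
  | |- poly (fun x => isout (@?a x) (@?b x)) => apply: (poly_app2 poly_isout0)
  | |- poly (fun x => att (@?a x) (@?b x) (@?c x)) => apply: (poly_app3 poly_att0)
  | |- _ => poly_def3
  end.
Ltac poly_def ::= poly_def4.

Lemma poly_adj0 : poly (fun p => adj p.1.1 p.1.2 p.2).
Proof. by rewrite /adj; polys. Qed.
Lemma poly_vs0 : poly vs.
Proof. by rewrite /vs; polys. Qed.
Lemma poly_vs X `{Enc X} (l : X -> seq nat) : poly l -> poly (fun x => vs (l x)).
Proof. by move=> Hl; apply: (poly_comp Hl poly_vs0). Qed.
Lemma poly_xorl0 : poly (fun p => xorl p.1.1 p.1.2 p.2).
Proof. by rewrite /xorl; polys. Qed.
Ltac poly_def5 := lazymatch goal with
  | |- poly (fun x => adj (@?a x) (@?b x) (@?c x)) => apply: (poly_app3 poly_adj0)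
  | |- poly (fun x => vs (@?a x)) => apply: poly_vs
  | |- poly (fun x => xorl (@?a x) (@?b x) (@?c x)) => apply: (poly_app3 poly_xorl0)
  | |- _ => poly_def4
  end.
Ltac poly_def ::= poly_def5.

Lemma poly_oddat0 : poly (fun p => oddat p.1.1 p.1.2 p.2).
Proof. by rewrite /oddat; polys. Qed.
Ltac poly_def6 := lazymatch goal with
  | |- poly (fun x => oddat (@?a x) (@?b x) (@?c x)) => apply: (poly_app3 poly_oddat0)
  | |- _ => poly_def5
  end.
Ltac poly_def ::= poly_def6.

Lemma poly_elim_row0 : poly (fun p => elim_row p.1.1 p.1.2 p.2).
Proof. by rewrite /elim_row; polys. Qed.
Lemma poly_gens00 : poly (fun p => gens0 p.1 p.2).
Proof. by rewrite /gens0; polys. Qed.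
Lemma poly_rows0 : poly (fun p => rows p.1.1 p.1.2 p.2).
Proof. by rewrite /rows; polys. Qed.

Lemma mem_vs l v : v \in vs l -> v < NN l.
Proof. by rewrite mem_filter mem_iota => /andP[_ /andP[_]]. Qed.

Lemma size_vs l : size (vs l) <= NN l.
Proof. by rewrite size_filter (leq_trans (count_size _ _)) // size_iota. Qed.

Definition small (N : nat) (C : seq nat) := (size C <= N) && all (fun i => i < N) C.

Lemma sz_seqseq N (G : seq (seq nat)) : all (small N) G ->
  sz G <= size G * (N * N.*2.+2 + 2) + 1.
Proof.
elim: G => // C G IH /andP[/andP[sC /sz_seqnat bC] /IH].
have E : sz (C :: G) = (sz C + sz G).+1 by exact: sz_cons.
have : size C * N.*2.+2 <= N * N.*2.+2 by rewrite leq_mul2r sC orbT.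
by rewrite E /=; lia.
Qed.

(** Entries are coded in unary, so each is at most the size of [l], and [NN] is a sum of three of
    them. *)
Lemma NN_le l : NN l <= 3 * sz l.
Proof.
have H n : nth 0 l n <= sz l.
  elim: l n => [|a l IH] [|n] //=; rewrite sz_cons sz_nat; first by lia.
  by have := IH n; lia.
by have := H 0; have := H (nn l + nn l + nn l).+1; rewrite -/(nn l) -/(mm l) /NN; lia.
Qed.

Lemma small_xorl l C D : small (NN l) (xorl l C D).
Proof.
apply/andP; split; last by apply/allP => i; rewrite mem_filter mem_iota => /andP[_ /andP[]].
by rewrite size_filter (leq_trans (count_size _ _)) // size_iota.
Qed.

(** The pivot is discarded and every other odd generator is replaced by a single sum, so the number
    of generators cannot increase. *)
Lemma elim_row_small l G w :
  all (small (NN l)) G -> all (small (NN l)) (elim_row l G w) /\ size (elim_row l G w) <= size G.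
Proof.
move=> aG; rewrite all_cat size_cat size_map; split.
  apply/andP; split; first by apply/allP => C; rewrite mem_filter => /andP[_ /(allP aG)].
  by apply/allP => C /mapP[D _ ->]; apply: small_xorl.
rewrite size_behead !size_filter -(count_predC (oddat l w) G) addnC.
by rewrite leq_add ?leq_pred.
Qed.

Lemma elim_rows_small l G ws : all (small (NN l)) G ->
  all (small (NN l)) (foldl (elim_row l) G ws) /\ size (foldl (elim_row l) G ws) <= size G.
Proof.
elim: ws G => //= w ws IH G aG; have [a1 s1] := elim_row_small w aG.
by have [a2 s2] := IH _ a1; split=> //; apply: leq_trans s2 s1.
Qed.

Lemma gens0_small l L : all (small (NN l)) (gens0 l L) /\ size (gens0 l L) <= NN l.
Proof.
split; last first.
  by rewrite size_map (leq_trans _ (size_vs l)) // size_filter count_size.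
apply/allP => C /mapP[a]; rewrite mem_filter => /andP[_ /mem_vs aN] ->.
by rewrite /small /= aN !andbT; apply: leq_ltn_trans aN.
Qed.

Lemma poly_solve0 : poly (fun p => solve p.1.1 p.1.2 p.2).
Proof.
rewrite /solve; apply: poly_filter; last by polys.
apply: (@poly_foldl _ _ _ _ _ _ (fun p => elim_row p.1.1) (fun p => rows p.1.1 p.1.2 p.2)
   (fun p => gens0 p.1.1 p.1.2)).
- exact: poly_rows0.
- by apply: (poly_app2 poly_gens00); polys.
- by apply: (poly_app3 poly_elim_row0); polys.
(* At most [NN] lists of at most [NN] numbers below [NN], with [3 * n] in place of [NN]. *)
exists (fun n => (3 * n) * ((3 * n) * (2 * (3 * n) + 2) + 2) + 1); first by pbs.
case=> [[l L] u] m /=; have [aG sG] := gens0_small l L.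
have [a1 s1] := elim_rows_small (take m (rows l L u)) aG.
apply: leq_trans (sz_seqseq a1) _; rewrite leq_add2r.
have Nl := NN_le l.
have nl : NN l <= 3 * sz (l, L, u).
  by apply: leq_trans Nl _; rewrite leq_mul2l !sz_pair; lia.
by apply: leq_mul; [lia | rewrite leq_add2r; apply: leq_mul; lia].
Qed.
Ltac poly_def7 := lazymatch goal with
  | |- poly (fun x => solve (@?a x) (@?b x) (@?c x)) => apply: (poly_app3 poly_solve0)
  | |- _ => poly_def6
  end.
Ltac poly_def ::= poly_def7.

Lemma poly_bad0 : poly (fun p => bad p.1.1 p.1.2 p.2).
Proof. by rewrite /bad; polys. Qed.
Ltac poly_def8 := lazymatch goal with
  | |- poly (fun x => bad (@?a x) (@?b x) (@?c x)) => apply: (poly_app3 poly_bad0)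
  | |- _ => poly_def7
  end.
Ltac poly_def ::= poly_def8.

Lemma poly_addable0 : poly (fun p => addable p.1.1 p.1.2 p.2).
Proof. by rewrite /addable; polys. Qed.
Ltac poly_def9 := lazymatch goal with
  | |- poly (fun x => addable (@?a x) (@?b x) (@?c x)) => apply: (poly_app3 poly_addable0)
  | |- _ => poly_def8
  end.
Ltac poly_def ::= poly_def9.

Lemma poly_gstep0 : poly (fun p => gstep p.1 p.2).
Proof. by rewrite /gstep; polys. Qed.

Lemma gstep_inv l L : uniq L -> {subset L <= vs l} ->
  uniq (gstep l L) /\ {subset gstep l L <= vs l}.
Proof.
move=> uL sL; rewrite /gstep; case E : [seq v <- vs l | _] => [|v t] //=.
have : v \in v :: t by rewrite mem_head.
rewrite -E mem_filter => /andP[/andP[vL _] vv]; rewrite take0 /= vL; split=> //.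
by move=> x; rewrite inE => /predU1P[->|/sL].
Qed.

Lemma gsteps_inv l ws L : uniq L -> {subset L <= vs l} ->
  uniq (foldl (fun L _ => gstep l L) L ws) /\
  {subset foldl (fun L (_ : nat) => gstep l L) L ws <= vs l}.
Proof.
elim: ws L => //= w ws IH L uL sL; have [u1 s1] := gstep_inv uL sL; exact: IH.
Qed.

Lemma poly_greedy : poly greedy.
Proof.
rewrite /greedy.
apply: (@poly_foldl _ _ _ _ _ _ (fun l L _ => gstep l L) (fun l => iota 0 (NN l)) (fun _ => [::])).
- by polys.
- exact: poly_const.
- by apply: (poly_app2 poly_gstep0); polys.
exists (fun n => (3 * n) * (2 * (3 * n) + 2) + 1); first by pbs.
move=> l m; have [uL sL] := @gsteps_inv l (take m (iota 0 (NN l))) [::] isT (fun _ => ltac:(done)).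
set L := foldl _ _ _ in uL sL *; have Nl := NN_le l.
have sz1 : size L <= NN l by apply: leq_trans (size_vs l); apply: uniq_leq_size.
apply: leq_trans (@sz_seqnat (NN l) _ _) _.
  by apply/allP => i /sL /mem_vs.
by rewrite leq_add2r; apply: leq_mul; lia.
Qed.

Lemma poly_after0 : poly (fun p => after p.1 p.2).
Proof. by rewrite /after; polys. Qed.
Lemma poly_pairs0 : poly pairs.
Proof. by rewrite /pairs; polys. Qed.
Lemma poly_pairs X `{Enc X} (l : X -> seq nat) : poly l -> poly (fun x => pairs (l x)).
Proof. by move=> Hl; apply: (poly_comp Hl poly_pairs0). Qed.
Ltac poly_def10 := lazymatch goal with
  | |- poly (fun x => after (@?a x) (@?b x)) => apply: (poly_app2 poly_after0)
  | |- poly (fun x => pairs (@?a x)) => apply: poly_pairs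
  | |- _ => poly_def9
  end.
Ltac poly_def ::= poly_def10.

Lemma poly_fval0 : poly (fun p => fval p.1.1 p.1.2 p.2).
Proof. by rewrite /fval; polys. Qed.
Lemma poly_csets0 : poly (fun p => csets p.1 p.2).
Proof. by rewrite /csets; polys. Qed.
Ltac poly_def11 := lazymatch goal with
  | |- poly (fun x => fval (@?a x) (@?b x) (@?c x)) => apply: (poly_app3 poly_fval0)
  | |- poly (fun x => csets (@?a x) (@?b x)) => apply: (poly_app2 poly_csets0)
  | |- _ => poly_def10
  end.
Ltac poly_def ::= poly_def11.
Lemma poly_answer0 : poly (fun p => answer p.1 p.2).
Proof. by rewrite /answer; polys. Qed.

Lemma poly_decode : poly decode.
Proof.
rewrite /decode; apply: poly_rev; apply: poly_snd.
apply: (@poly_foldl_add _ _ _ _ _ _ (fun _ => decode_step) (fun w => w) (fun _ => (0, [::]))).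
- exact: poly_id.
- exact: poly_const.
- by rewrite /decode_step; polys.
by exists 4, 0 => x [n s] b; case: b; rewrite /decode_step /= !sz_pair ?sz_cons !sz_nat; lia.
Qed.

Lemma poly_pfflow_alg : poly pfflow_alg.
Proof.
rewrite /pfflow_alg /enc_nats /enc_nat.
have Hn : poly (fun n => nseq n true ++ [:: false]).
  apply: poly_cat; last exact: poly_const.
  have : poly (fun n => map (fun _ => true) (nseq n tt)).
    by apply: poly_map; [exact/poly_units/poly_id | exact: poly_const].
  by move/poly_ext; apply=> n; rewrite map_nseq.
apply: poly_flatten; apply: (poly_map (f := fun _ n => nseq n true ++ [:: false])).
  apply: (poly_app2 poly_answer0); first exact: poly_decode.
  exact: (poly_comp poly_decode poly_greedy).
exact: (poly_comp (poly_snd poly_id) Hn).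
Qed.

Lemma decode_enc_nats l : decode (enc_nats l) = l.
Proof.
rewrite /decode /enc_nats.
suff H s : foldl decode_step (0, s) (flatten (map enc_nat l)) = (0, catrev l s).
  by rewrite H /= -/(rev l) revK.
elim: l s => //= n l IH s; rewrite /enc_nat -catA foldl_cat.
have H m : foldl decode_step (m, s) (nseq n true) = (m + n, s).
  by elim: n m => [|n IHn] m /=; rewrite ?addn0 // /decode_step IHn addSnnS.
rewrite H; exact: IH.
Qed.

Theorem pfflow_alg_halts : exists M c k, forall l,
  halts_within M (enc_nats l) (c * (size (enc_nats l)).+1 ^ k)
    (enc_nats (answer l (greedy l))).
Proof.
have [M [c [k H]]] := poly_halts poly_pfflow_alg; exists M, c, k => l.
by have := H (enc_nats l); rewrite /pfflow_alg decode_enc_nats.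
Qed.

(** * Linear algebra over the two-element field *)

Section Span.
Variable l : seq nat.
Notation N := (NN l).

Definition ph (w : nat) (p : nat -> bool) : bool :=
  odd (count (fun i => p i && adj l w i) (iota 0 N)).

Lemma odd_count_addb (T : Type) (s : seq T) (p q : pred T) :
  odd (count (fun i => p i (+) q i) s) = odd (count p s) (+) odd (count q s).
Proof.
by elim: s => //= i s IH; rewrite !oddD !oddb IH addbACA.
Qed.

Lemma phD w p q : ph w (fun i => p i (+) q i) = ph w p (+) ph w q.
Proof.
rewrite /ph -odd_count_addb; congr odd; apply: eq_count => i /=.
by rewrite andb_addl.
Qed.

Lemma eq_ph w p q : (forall i, i < N -> p i = q i) -> ph w p = ph w q.
Proof.
move=> E; congr odd; apply: eq_in_count => i.
by rewrite mem_iota => /andP[_ iN]; rewrite E.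
Qed.

(* [C] lists a subset of the vertex indices in increasing order. *)
Definition good (C : seq nat) := C = [seq i <- iota 0 N | i \in C].

Lemma good_filter p : good (filter p (iota 0 N)).
Proof.
apply/eq_in_filter => i; rewrite mem_filter => ->.
by rewrite andbT.
Qed.

Lemma good_lt C i : good C -> i \in C -> i < N.
Proof. by move=> gC; rewrite gC mem_filter mem_iota => /andP[_ /andP[]]. Qed.

Lemma oddatE w C : good C -> oddat l w C = ph w (mem C).
Proof.
move=> gC; rewrite /oddat {1}gC count_filter; congr odd.
by apply: eq_count => i; rewrite /= andbC.
Qed.

Lemma good_xorl C D : good (xorl l C D).
Proof. exact: good_filter. Qed.

Lemma mem_xorl C D i : i < N -> (i \in xorl l C D) = (i \in C) (+) (i \in D).
Proof. by move=> iN; rewrite mem_filter mem_iota add0n iN leq0n !andbT. Qed.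

Lemma oddat_xorl w C D : good C -> good D ->
  oddat l w (xorl l C D) = oddat l w C (+) oddat l w D.
Proof.
move=> gC gD; rewrite !oddatE //; last exact: good_xorl.
by rewrite -phD; apply: eq_ph => i iN; apply: mem_xorl.
Qed.

(** Subsets are predicates that matter only below [N]; sums then need no normal form. *)
Inductive span (G : seq (seq nat)) : (nat -> bool) -> Prop :=
| span_nil p : (forall i, i < N -> p i = false) -> span G p
| span_add C p q : C \in G -> span G p -> (forall i, i < N -> q i = (i \in C) (+) p i) ->
    span G q.

Lemma span_ext G p q : span G p -> (forall i, i < N -> p i = q i) -> span G q.
Proof.
case=> [p' E|C p' q' CG sp E] F; first by apply: span_nil => i iN; rewrite -F ?E.
by apply: span_add CG sp _ => i iN; rewrite -F ?E.
Qed.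

(** Projection along the pivot onto the sets even at [w]: an odd [p] gets the pivot added, an even
    one is unchanged. The projection is linear in [p], so induction on the span applies. With no odd
    generator, the default [[::]] makes the correction void. *)
Lemma span_elim_row G w p : (forall C, C \in G -> good C) -> span G p ->
  span (elim_row l G w)
    (fun i => (ph w p && (i \in head [::] [seq C <- G | oddat l w C])) (+) p i).
Proof.
move=> gG; set odds := filter _ _; set h := head _ _.
have memE C : C \in G -> ~~ oddat l w C -> C \in elim_row l G w.
  by move=> CG oC; rewrite mem_cat mem_filter oC CG.
have memO C : C \in G -> oddat l w C -> C = h \/ xorl l h C \in elim_row l G w.
  move=> CG oC; have : C \in odds by rewrite mem_filter oC CG.
  rewrite /elim_row -/odds -/h /h; case: (odds) => //= a t.
  rewrite inE => /predU1P[->|Ct]; first by left.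
  by right; rewrite mem_cat map_f ?orbT.
elim=> {p} [p E|C p q CG sp IH E].
  apply: span_nil => i iN; rewrite E // addbF.
  have -> : ph w p = false; last by [].
  by rewrite (@eq_ph w p (fun=> false)) // /ph; elim: iota.
have phq : ph w q = oddat l w C (+) ph w p.
  by rewrite (oddatE _ (gG _ CG)) -phD; apply: eq_ph => i iN; rewrite E.
rewrite phq; case: (boolP (oddat l w C)) => oC.
  (* Adding the pivot itself also flips the parity at [w], so the projection does not change. *)
  case: (memO C CG oC) => [Ch|Cx].
    apply: span_ext IH _ => i iN; rewrite E // Ch.
    by case: (ph w p); case: (_ \in h); case: (p i).
  apply: span_add Cx IH _ => i iN; rewrite E // mem_xorl //.
  by case: (ph w p); case: (_ \in h); case: (_ \in C); case: (p i).
apply: span_add (memE _ CG oC) IH _ => i iN; rewrite E //.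
by case: (ph w p); case: (_ \in h); case: (_ \in C); case: (p i).
Qed.

Definition row_inv (Q : pred nat) (ws : seq nat) (G : seq (seq nat)) :=
  forall C, C \in G ->
    [/\ good C, (forall i, i \in C -> Q i) & forall w, w \in ws -> ~~ oddat l w C].

Lemma elim_row_inv Q ws G w : row_inv Q ws G -> row_inv Q (w :: ws) (elim_row l G w).
Proof.
move=> inv C; rewrite mem_cat mem_filter => /orP[/andP[oC /inv[gC QC wC]]|].
  by split=> // x; rewrite inE => /predU1P[->|/wC].
case E : [seq C <- G | oddat l w C] => [|h t] //= /mapP[D Dt ->].
have : h \in h :: t by rewrite mem_head.
rewrite -E mem_filter => /andP[oh /inv[gh Qh wh]].
have : D \in h :: t by rewrite inE Dt orbT.
rewrite -E mem_filter => /andP[oD /inv[gD QD wD]].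
split; first exact: good_xorl.
  move=> i ix; have iN := good_lt (good_xorl _ _) ix.
  move: ix; rewrite mem_xorl //; case: (boolP (i \in h)) => [/Qh //|_] /=; exact: QD.
move=> x; rewrite oddat_xorl // inE => /predU1P[->|xw]; first by rewrite oh oD.
by rewrite (negbTE (wh _ xw)) (negbTE (wD _ xw)).
Qed.

Lemma elim_rows_inv Q rs ws G : row_inv Q ws G ->
  row_inv Q (catrev rs ws) (foldl (elim_row l) G rs).
Proof. by elim: rs ws G => //= r rs IH ws G inv; apply: IH; apply: elim_row_inv. Qed.

(** A set satisfying all the equations is fixed by each of the successive projections, hence never
    leaves the span. *)
Lemma span_elim_rows Q ws rs G p : row_inv Q ws G -> span G p ->
  (forall w, w \in rs -> ph w p = false) -> span (foldl (elim_row l) G rs) p.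
Proof.
elim: rs ws G => //= r rs IH ws G inv sp prs.
apply: IH (elim_row_inv (w := r) inv) _ _; last by move=> w wr; rewrite prs // inE wr orbT.
have gG C : C \in G -> good C by case/inv.
apply: span_ext (span_elim_row r gG sp) _ => i _.
by rewrite prs ?mem_head.
Qed.

Lemma span_odd G u p : (forall C, C \in G -> good C) -> span G p -> ph u p ->
  has (oddat l u) G.
Proof.
move=> gG sp; apply: contraTT => /hasPn noG.
elim: sp => {p} [p E|C p q CG sp IH E].
  by rewrite (@eq_ph u p (fun=> false)) // /ph; elim: iota.
have -> : ph u q = oddat l u C (+) ph u p.
  by rewrite (oddatE _ (gG _ CG)) -phD; apply: eq_ph => i iN; rewrite E.
by rewrite (negbTE IH) (negbTE (noG _ CG)).
Qed.

Lemma gens0_inv L : row_inv (fun i => (i \in vs l) && ((i \in L) || isP l i)) [::] (gens0 l L).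
Proof.
move=> C /mapP[a]; rewrite mem_filter => /andP[aL av] ->.
split=> // [|i]; last by rewrite inE => /eqP ->; rewrite av.
have aN := mem_vs av.
rewrite /good; apply/esym; apply: (@eq_trans _ _ [seq i <- iota 0 N | i == a]).
  by apply: eq_filter => i; rewrite inE.
by rewrite filter_pred1_uniq ?iota_uniq // mem_iota.
Qed.

Lemma span_gens0 L (p : pred nat) :
  (forall i, p i -> (i \in vs l) && ((i \in L) || isP l i)) -> span (gens0 l L) p.
Proof.
move=> Hp.
suff H s : uniq s -> all p s -> span (gens0 l L) (mem s).
  apply: span_ext (H (filter p (iota 0 N)) _ (filter_all _ _)) _.
    by rewrite filter_uniq // iota_uniq.
  by move=> i iN /=; rewrite mem_filter mem_iota add0n iN leq0n !andbT.
elim: s => [|a s IH] /=; first by move=> _ _; apply: span_nil.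
move=> /andP[as' us] /andP[pa ps].
apply: (@span_add _ [:: a] _ _ _ (IH us ps)) => [|i iN] /=.
  by apply/mapP; exists a => //; rewrite mem_filter andbC; apply: Hp.
rewrite !inE; case: eqP => //= ->; by rewrite (negbTE as').
Qed.

Lemma solve_sound L u C : C \in solve l L u ->
  [/\ good C, (forall i, i \in C -> (i \in vs l) && ((i \in L) || isP l i)), oddat l u C
    & forall w, w \in vs l -> w \notin L -> w != u -> ~~ oddat l w C].
Proof.
rewrite mem_filter => /andP[oC CG].
have [gC QC wC] := elim_rows_inv (rs := rows l L u) (gens0_inv (L := L)) CG.
split=> // w wv wL wu; apply: wC; rewrite catrevE mem_cat mem_rev mem_filter.
by rewrite wL wu wv.
Qed.

Lemma solve_complete L u (p : pred nat) :
  (forall i, p i -> (i \in vs l) && ((i \in L) || isP l i)) -> ph u p ->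
  (forall w, w \in vs l -> w \notin L -> w != u -> ph w p = false) ->
  ~~ nilp (solve l L u).
Proof.
move=> Hp pu pw; rewrite /nilp size_filter -lt0n -has_count.
have sp := span_gens0 Hp; have inv := @gens0_inv L.
apply: span_odd (span_elim_rows inv sp _) pu.
  by move=> C /(elim_rows_inv (rs := rows l L u) inv)[].
by move=> w; rewrite mem_filter => /andP[/andP[wL wu] wv]; apply: pw.
Qed.

End Span.

(** * The greedy order *)

Lemma mem_drop_uniq (L : seq nat) k b : uniq L ->
  (b \in drop k L) = (b \in L) && (k <= index b L).
Proof.
elim: L k => [|c L IH] [|k] //= /andP[cL uL]; first by rewrite leq0n !andbT.
rewrite IH // inE eq_sym; case: (eqVneq c b) => [<-|] //=.
by rewrite (negbTE cL).
Qed.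

Lemma afterE L a : after L a = drop (index a L).+1 L.
Proof. by rewrite /after -drop1 drop_drop add1n. Qed.

Lemma mem_after L a b : uniq L ->
  (b \in after L a) = (b \in L) && (index a L < index b L).
Proof. by move=> uL; rewrite afterE mem_drop_uniq. Qed.

Lemma mem_pairs L a b : uniq L ->
  ((a, b) \in pairs L) = [&& a \in L, b \in L & index a L <= index b L].
Proof.
move=> uL; apply/flatten_mapP/and3P => [[x xL /mapP[y yd [-> ->]]]|[aL bL ab]].
  by move: yd; rewrite mem_drop_uniq // => /andP[].
by exists a => //; apply/mapP; exists b => //; rewrite mem_drop_uniq // bL.
Qed.

Section Greedy.
Variable l : seq nat.

Lemma greedy_uniq : uniq (greedy l).
Proof. by case: (@gsteps_inv l (iota 0 (NN l)) [::] isT (fun _ => ltac:(done))). Qed.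

Lemma greedy_sub : {subset greedy l <= vs l}.
Proof. by case: (@gsteps_inv l (iota 0 (NN l)) [::] isT (fun _ => ltac:(done))). Qed.

Lemma gstepE L : [seq v <- vs l | (v \notin L) && addable l L v] = [::] /\ gstep l L = L \/
  exists v, [/\ v \notin L, addable l L v & gstep l L = v :: L].
Proof.
rewrite /gstep; case E : [seq v <- vs l | _] => [|v t]; first by left.
right; exists v; have : v \in v :: t by rewrite mem_head.
by rewrite -E mem_filter => /andP[/andP[vL av] _]; split=> //; rewrite E /= take0.
Qed.

(** Each round either adds a vertex or has reached a fixed point. If all [NN l] rounds add one, the
    list is as long as [vs l] can be and nothing is left out. *)
Lemma greedy_stuck v : v \in vs l -> v \notin greedy l -> ~~ addable l (greedy l) v.
Proof.
move=> vv vL.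
have H ws : size (foldl (fun L (_ : nat) => gstep l L) [::] ws) = size ws \/
    gstep l (foldl (fun L _ => gstep l L) [::] ws) = foldl (fun L _ => gstep l L) [::] ws.
  elim/last_ind: ws => [|ws w [IH|IH]]; first by left.
    rewrite foldl_rcons size_rcons; case: (gstepE (foldl (fun L _ => gstep l L) [::] ws)).
      by move=> [_ E]; right; rewrite !E.
    by move=> [x [_ _ ->]]; left; rewrite /= IH.
  by right; rewrite foldl_rcons !IH.
have st : gstep l (greedy l) = greedy l.
  case: (H (iota 0 (NN l))) => // sL.
  have szv : size (vs l) <= size (greedy l) by rewrite /greedy sL size_iota size_vs.
  have [_ E] := uniq_min_size greedy_uniq greedy_sub szv.
  by move: vv; rewrite -E (negbTE vL).
apply: contraL (eqxx (size (greedy l))) => av; rewrite -{1}st.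
case: (gstepE (greedy l)) => [[E _]|[x [_ _ ->]]]; last by rewrite /= eqn_leq ltnn.
have : v \in [seq v <- vs l | (v \notin greedy l) && addable l (greedy l) v].
  by rewrite mem_filter vL av vv.
by rewrite E.
Qed.

Lemma after_cons L v x : x != v -> after (v :: L) x = after L x.
Proof. by rewrite /after /= eq_sym => /negbTE ->. Qed.

(** Later vertices are put in front, so the tail for which [v] passed the test never changes. *)
Lemma greedy_addable v : v \in greedy l -> addable l (after (greedy l) v) v.
Proof.
rewrite /greedy; elim/last_ind: (iota 0 (NN l)) => //= ws w IH; rewrite foldl_rcons.
case: (gstepE (foldl (fun L _ => gstep l L) [::] ws)) => [[_ ->] //|[x [xL ax ->]]].
rewrite inE; case: (eqVneq v x) => [->|vx] /=; last by rewrite after_cons.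
by rewrite /after /= eqxx drop0.
Qed.

End Greedy.

(** * Signatures of diagrams *)

Lemma nth_block3 (T : Type) (x0 : T) (f g h : T -> nat) (s : seq T) k : k < size s ->
  nth 0 (flatten [seq [:: f x; g x; h x] | x <- s]) (k + k + k).+1 = g (nth x0 s k) /\
  nth 0 (flatten [seq [:: f x; g x; h x] | x <- s]) (k + k + k).+2 = h (nth x0 s k).
Proof.
elim: s k => // a s IH [|k] //= ks.
by rewrite !addnS !addSn /=; apply: IH.
Qed.

Lemma size_block3 (T : Type) (f g h : T -> nat) (s : seq T) :
  size (flatten [seq [:: f x; g x; h x] | x <- s]) = size s + size s + size s.
Proof. by elim: s => //= a s ->; rewrite !addnS !addSn. Qed.

Lemma nth_block2 (T : Type) (x0 : T) (f g : T -> nat) (s : seq T) k (b : bool) : k < size s ->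
  nth 0 (flatten [seq [:: f x; g x] | x <- s]) (k.*2 + b) =
  (if b then g else f) (nth x0 s k).
Proof.
elim: s k => // a s IH [|k] /= ks; first by case: (b).
exact: IH.
Qed.

Section Link.
Variable D : zx.
Notation n := (nnodes D).
Notation m := (nwires D).
Notation l := (code_zx D).
Notation vid := (@vidx D).

Lemma nn_code : nn l = n. Proof. by []. Qed.

Lemma code_zxE : l = n ::
  flatten [seq [:: code_kind (kind D i); nat_of_bool (phase_in_P (kind D i));
      nat_of_bool (phase_odd (kind D i))] | i <- enum 'I_n] ++
  m :: flatten [seq [:: code_ep w.1; code_ep w.2] | w <- wires D].
Proof. by []. Qed.

Lemma mm_code : mm l = m.
Proof.
rewrite /mm nn_code code_zxE [nth _ _ _.+1]/= nth_cat size_block3 size_enum_ord ltnn subnn.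
by [].
Qed.

Lemma NN_code : NN l = n + m.*2.
Proof. by rewrite /NN mm_code addnn. Qed.

Lemma ep_code (k : 'I_m) (b : bool) : ep l (n + k.*2 + b) = code_ep (wend D k b).
Proof.
rewrite /ep nn_code code_zxE [nth _ _ _.+2]/= nth_cat size_block3 size_enum_ord.
have -> : (n + n + (n + k.*2 + b)).+1 = n + n + n + (k.*2 + b).+1 by lia.
rewrite ltnNge leq_addr /= addKn /= (nth_block2 (EIn, EIn)); last exact: ltn_ord.
by rewrite /wend; case: b.
Qed.

Lemma isP_code (i : 'I_n) : isP l i = phase_in_P (kind D i).
Proof.
rewrite /isP nn_code ltn_ord code_zxE [nth _ _ _.+2]/= nth_cat size_block3 size_enum_ord.
have -> : (i + i + i).+1 < n + n + n by have := ltn_ord i; lia.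
have := @nth_block3 _ i (fun i => code_kind (kind D i))
  (fun i => nat_of_bool (phase_in_P (kind D i)))
  (fun i => nat_of_bool (phase_odd (kind D i))) (enum 'I_n) i.
by rewrite size_enum_ord ltn_ord => /(_ isT)[-> _]; rewrite nth_ord_enum lt0b.
Qed.

Lemma isodd_code (i : 'I_n) : isodd l i = phase_odd (kind D i).
Proof.
rewrite /isodd nn_code ltn_ord code_zxE [nth _ _ _.+3]/= nth_cat size_block3 size_enum_ord.
have -> : (i + i + i).+2 < n + n + n by have := ltn_ord i; lia.
have := @nth_block3 _ i (fun i => code_kind (kind D i))
  (fun i => nat_of_bool (phase_in_P (kind D i)))
  (fun i => nat_of_bool (phase_odd (kind D i))) (enum 'I_n) i.
by rewrite size_enum_ord ltn_ord => /(_ isT)[_ ->]; rewrite nth_ord_enum lt0b.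
Qed.

Lemma code_ep_open (e : endpoint n) : (code_ep e <= 1) = is_open e. Proof. by case: e. Qed.
Lemma code_ep_out (e : endpoint n) : (code_ep e == 1) = is_out e. Proof. by case: e. Qed.
Lemma code_ep_node (e : endpoint n) (i : 'I_n) : (code_ep e == i.+2) = is_node e i.
Proof. by case: e. Qed.

Lemma end_inj k (b : bool) k' (b' : bool) :
  (n + k.*2 + b == n + k'.*2 + b') = (k == k') && (b == b').
Proof. by case: b; case: b' => /=; apply/eqP/andP => [|[/eqP ->]] //; lia. Qed.

Lemma vidx_inj : injective vid.
Proof.
move=> [i|[k b]] [j|[k' b']] //= E.
- by congr inl; apply: val_inj.
- by have := ltn_ord i; lia.
- by have := ltn_ord j; lia.
by move/eqP: E; rewrite end_inj => /andP[/eqP/val_inj -> /eqP ->].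
Qed.

Lemma vidx_lt x : vid x < NN l.
Proof.
rewrite NN_code; case: x => [i|[k b]] /=; first by have := ltn_ord i; lia.
by have := ltn_ord k; case: b; lia.
Qed.

Lemma vidx_surj j : j < NN l -> exists x, vid x = j.
Proof.
rewrite NN_code => jN; have [jn|jn] := ltnP j n; first by exists (inl (Ordinal jn)).
have km : (j - n)./2 < m by lia.
exists (inr (Ordinal km, odd (j - n))) => /=; lia.
Qed.

Lemma att_vidx x (k : 'I_m) (b : bool) : att l (vid x) (n + k.*2 + b) = at_end D x k b.
Proof.
rewrite /att nn_code ep_code; case: x => [i|[k' b']] /=.
  by rewrite ltn_ord code_ep_node.
have -> : (n + k'.*2 + b' < n) = false by lia.
by rewrite end_inj code_ep_open.
Qed.

Lemma adj_vidx x y : adj l (vid x) (vid y) = sadj D x y.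
Proof.
have attF z (k : 'I_m) : att l (vid z) (nn l + (k + k)) = at_end D z k false.
  by rewrite -att_vidx addn0 addnn.
have attT z (k : 'I_m) : att l (vid z) (nn l + (k + k)).+1 = at_end D z k true.
  by rewrite -att_vidx addn1 addnn.
rewrite /adj /sadj mm_code (inj_eq vidx_inj); congr orb; last first.
  case: eqP => //= ->; case: y => [i|[k b]] /=; first exact: isodd_code.
  by rewrite /isodd nn_code; have -> : (n + k.*2 + b < n) = false by lia.
apply/hasP/existsP => [[k]|[k Hk]].
  rewrite mem_iota add0n => /andP[_ km]; exists (Ordinal km).
  by rewrite -!attF -!attT.
exists (k : nat); first by rewrite mem_iota /= ltn_ord.
by rewrite !attF !attT.
Qed.

Lemma mem_vs_vidx x : (vid x \in vs l) = (x \in VG D).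
Proof.
rewrite mem_filter mem_iota add0n vidx_lt leq0n !andbT inE /valid nn_code.
case: x => [i|[k b]]; first by rewrite /= ltn_ord.
rewrite ep_code code_ep_open /=.
by have -> : (n + k.*2 + b < n) = false by lia.
Qed.

Lemma vs_vidx j : j \in vs l -> exists2 x, x \in VG D & vid x = j.
Proof.
move=> jv; have [x E] := vidx_surj (mem_vs jv).
by exists x => //; rewrite -mem_vs_vidx E.
Qed.

Lemma isP_vidx x : isP l (vid x) = (x \in Pset D).
Proof.
rewrite inE; case: x => [i|[k b]]; first exact: isP_code.
by rewrite /isP nn_code /=; have -> : (n + k.*2 + b < n) = false by lia.
Qed.

Lemma isout_vidx x : isout l (vid x) = (x \in Oset D).
Proof.
rewrite inE /isout nn_code; case: x => [i|[k b]].
  by rewrite /= leqNgt ltn_ord.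
by rewrite ep_code code_ep_out /= -addnA leq_addr.
Qed.

(** The indices below [NN l] number all of [gv D], including the wire ends that are not vertices, so
    a count over indices is a cardinality in [gv D]. *)
Lemma ph_vidx x (p : pred nat) : ph l (vid x) p = odd #|[set c | p (vid c) && sadj D x c]|.
Proof.
have P : perm_eq (iota 0 (NN l)) [seq vid c | c <- enum (gv D)].
  apply: uniq_perm; first exact: iota_uniq.
    by rewrite map_inj_uniq ?enum_uniq //; apply: vidx_inj.
  move=> j; rewrite mem_iota add0n /=; apply/idP/mapP => [/vidx_surj[c <-]|[c _ ->]].
    by exists c; rewrite // mem_enum.
  exact: vidx_lt.
rewrite /ph (permP P) count_map -size_filter cardE enumT; congr (odd (size _)).
by apply: eq_filter => c; rewrite !inE /= adj_vidx.
Qed.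

Definition toset (C : seq nat) : {set gv D} := [set x in VG D | vid x \in C].

Lemma oddat_toset x C : good l C -> {subset C <= vs l} ->
  oddat l (vid x) C = odd #|[set c in toset C | sadj D x c]|.
Proof.
move=> gC sC; rewrite oddatE // ph_vidx; congr (odd #|pred_of_set _|).
apply/setP => c; rewrite !inE; case: (boolP (vid c \in C)) => [/sC|] /=.
  by rewrite mem_vs_vidx inE => ->.
by rewrite andbF.
Qed.

(* The order only enters through the set [L] of vertices above the corrected one. *)
Definition corrects (L : seq nat) (C : {set gv D}) (u : gv D) : Prop :=
  u \in OddS D C /\
  forall w, w \in (C :\: Pset D) :|: (OddS D C :\ u) -> vid w \in L.

Lemma solve_corrects L (u : gv D) (C : seq nat) :
  u \in VG D -> C \in solve l L (vid u) -> corrects L (toset C) u.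
Proof.
move=> uV /solve_sound[gC QC oC wC].
have sC : {subset C <= vs l} by move=> i /QC /andP[].
split; first by rewrite inE uV -oddat_toset.
move=> w; rewrite !inE => /orP[/andP[wP /andP[wV wC']]|/and3P[wu wV]].
  have := QC _ wC'; rewrite isP_vidx => /andP[_ /orP[//|]].
  by rewrite inE (negbTE wP).
have wV' : w \in VG D by rewrite inE.
move=> ow; apply: contraT => wL.
have := wC (vid w); rewrite mem_vs_vidx wV' wL (inj_eq vidx_inj) wu => /(_ isT isT isT).
by rewrite oddat_toset // ow.
Qed.

Lemma corrects_solve L (u : gv D) (C : {set gv D}) : C \subset VG D -> corrects L C u ->
  ~~ nilp (solve l L (vid u)).
Proof.
move=> /subsetP CV [uO HC].
pose p i := [exists c in C, vid c == i].
have pE c : p (vid c) = (c \in C).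
  apply/existsP/idP => [[d /andP[dC /eqP/vidx_inj <-]] //|cC].
  by exists c; rewrite cC eqxx.
have phE w : ph l (vid w) p = odd #|[set c in C | sadj D w c]|.
  by rewrite ph_vidx; congr (odd #|pred_of_set _|); apply/setP => c; rewrite !inE pE.
apply: (@solve_complete _ _ _ p).
- move=> i /existsP[c /andP[cC /eqP <-]]; rewrite mem_vs_vidx CV // isP_vidx /=.
  apply: contraT; rewrite negb_or => /andP[cL cP].
  by rewrite HC ?in_setU ?in_setD ?cC ?cP in cL.
- by move: uO; rewrite inE phE => /andP[].
move=> j /vs_vidx[w wV <-] wL; rewrite (inj_eq vidx_inj) phE => wu.
apply: contraNF wL => ow; apply: HC; apply/setUP; right.
by rewrite in_setD1 wu inE wV ow.
Qed.

Lemma sadj_sym x y : sadj D x y = sadj D y x.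
Proof.
rewrite /sadj; congr orb.
  by apply: eq_existsb => k; rewrite orbC; congr orb; rewrite andbC.
by rewrite eq_sym; case: eqP => // ->.
Qed.

End Link.

(** * Correctness of the greedy algorithm *)

Section Correct.
Variable D : zx.
Hypothesis gl : graph_like D.
Notation n := (nnodes D).
Notation l := (code_zx D).
Notation vid := (@vidx D).
Notation L := (greedy l).

Lemma spider i : i \in spiders D.
Proof. by rewrite inE; case: gl => H _ _ _; case E : (kind D i) => //; case: (H i). Qed.

Lemma Oset_Iset x : x \in Oset D -> x \notin Iset D.
Proof. by rewrite !inE; case: x => // [[k b]]; case: (wend D k b). Qed.

Lemma VG_cases x : x \in VG D -> [\/ exists i, x = inl i, x \in Oset D | x \in Iset D].
Proof.
case: x => [i|[k b]]; first by constructor 1; exists i.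
by rewrite !inE; case: (wend D k b) => // _; [constructor 3 | constructor 2].
Qed.

(** Choose an element with the fewest elements of [S] above it; by transitivity and antisymmetry,
    anything above it would have fewer. *)
Lemma exists_maximal (le : rel (gv D)) (S : {set gv D}) :
  partial_order_on D le -> S != set0 ->
  exists2 x, x \in S & forall y, y \in S -> ~~ lt D le x y.
Proof.
move=> [_ _ anti tra] /set0Pn[x0 x0S].
case: (@arg_minnP _ x0 (mem S) (fun x => #|[set y in S | lt D le x y]|) x0S) => x xS xmin.
exists x => // y yS; apply/negP => xy.
have := xmin y yS; rewrite leqNgt => /negP; apply; apply: proper_card.
apply/properP; split; last by exists y; rewrite !inE yS /lt ?eqxx ?andbF //.
apply/subsetP => z; rewrite !inE => /andP[-> /andP[yz nyz]] /=.
move/andP: xy => [xy nxy]; rewrite /lt (tra _ _ _ xy yz) /=.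
by apply: contra nxy => /eqP xz; rewrite -xz in yz; apply/eqP; apply: anti.
Qed.

Lemma greedy_complete : has_PFflow D -> all (fun v => v \in L) (vs l).
Proof.
move=> [le [f [CC [po fV CCV H]]]]; apply/allP => j jv.
apply: contraT => jL; have [x0 x0V x0j] := vs_vidx jv.
pose S := [set x in VG D | vid x \notin L].
have S0 : S != set0 by apply/set0Pn; exists x0; rewrite inE x0V x0j.
have [x xS xmax] := exists_maximal po S0.
have [leV _ _ _] := po.
(* By maximality, all that the given flow puts above [x] has been added, so its correctors at [x]
   are admissible for [L]. *)
have up y : lt D le x y -> vid y \in L.
  move=> xy; apply: contraT => yL; have [_ yV] := leV _ _ (proj1 (andP xy)).
  by have := xmax y; rewrite inE yV yL xy => /(_ isT).
move: xS; rewrite inE => /andP[xV xL].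
have := greedy_stuck (_ : vid x \in vs l) xL; rewrite mem_vs_vidx => /(_ xV) /negP[].
rewrite /addable nn_code.
have corr C u : C \in CC -> corrector D le C x u -> ~~ nilp (solve l L (vid u)).
  move=> CCC [uO HC]; apply: (@corrects_solve D _ _ C); first exact: CCV.
  by split=> // w /HC /up.
have [[i xi]|xO|xI] := VG_cases xV.
- subst x; rewrite [vid _]/= ltn_ord; have [Hi Hii Hiii] := H i (spider i).
  apply/and3P; split.
  + apply/allP => k /vs_vidx[u uV <-].
    rewrite isout_vidx -[nat_of_ord i]/(vid (inl i)) adj_vidx.
    apply/negP => /and3P[uO au uL]; have := Hi u uV au; rewrite uO andbF /= => /andP[leu _].
    case/negP: uL; apply: up; rewrite /lt leu /=.
    by apply: contraL uO => /eqP <-; rewrite inE.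
  + case: (posnP #|Nplus D le (inl i)|) => [/Hii[C CCC cC]|].
      by rewrite [X in _ || X](corr _ _ CCC cC) orbT.
    rewrite card_gt0 => /set0Pn[u]; rewrite inE => /andP[uV /andP[au lu]].
    apply/orP; left; apply/hasP; exists (vid u); first by rewrite mem_vs_vidx.
    by rewrite (up _ lu) -[nat_of_ord i]/(vid (inl i)) adj_vidx.
  (* A neighbour outside [L] is not above the spider, hence below it by condition (i). By condition
     (iii), only [f i] can then lack a corrector. *)
  have sub : {subset bad l L i <= [:: vid (f i)]}.
    move=> k; rewrite mem_filter => /andP[/and4P[kL ki ak sk] /vs_vidx[u uV Eu]].
    move: kL ki ak sk; rewrite -{k}Eu -[nat_of_ord i]/(vid (inl i)) (inj_eq (@vidx_inj D)) adj_vidx.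
    move=> uL ui au su; rewrite inE (inj_eq (@vidx_inj D)); apply: contraT => uf.
    have um : u \in Nminus D le (inl i).
      rewrite inE uV au /lt ui /= andbT; have := Hi u uV au.
      case/orP => /andP[le1 _] //; case/negP: uL; apply: up.
      by rewrite /lt le1 eq_sym.
    have [C CCC cC] := Hiii u um uf.
    by have := corr _ _ CCC cC; rewrite su.
  have ub : uniq (bad l L i) by rewrite !filter_uniq // iota_uniq.
  exact: (uniq_leq_size ub sub).
- case: ifP => [|_]; last by rewrite isout_vidx xO.
  by move: xO; rewrite inE; case: (x) => // -[k b] _ /=; lia.
case: ifP => [|_].
  by move: xI; rewrite inE; case: (x) => // -[k b] _ /=; lia.
apply/orP; right; apply/allP => k /vs_vidx[u uV <-]; apply/negP => /and3P[un].
rewrite adj_vidx => au uL.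
have [i ui] : exists i, u = inl i.
  case: (u) un => [i _|[k' b]] /=; first by exists i.
  by lia.
(* Condition (i) at the spider forbids the input [x] to be above it, so the spider is above [x] and
   already in [L]. *)
subst u; have [Hi _ _] := H i (spider i).
have := Hi x xV; rewrite sadj_sym => /(_ au).
rewrite xI andbF orbF => /andP[lexu _]; case/negP: uL; apply: up.
by rewrite /lt lexu; apply: contraTneq xI => ->; rewrite inE.
Qed.

(** A finite search yields the vertex as data, which is needed to define the map of the flow. *)
Lemma vidx_pick (j : nat) : j \in vs l -> {x : gv D | x \in VG D & vid x = j}.
Proof.
move=> jv; case: (pickP (fun x => (x \in VG D) && (vid x == j))) => [x /andP[xV /eqP E]|no].
  by exists x.
by exfalso; have [x xV E] := vs_vidx jv; have := no x; rewrite xV E eqxx.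
Qed.

Lemma fval_vs (i : 'I_n) : fval l L i \in vs l.
Proof.
have vi : nat_of_ord i \in vs l by rewrite -[nat_of_ord i]/(vid (inl i)) mem_vs_vidx inE.
rewrite /fval; case E : (bad _ _ _) => [|a s] //=.
have : a \in bad l (after L i) i by rewrite E mem_head.
by rewrite mem_filter => /andP[].
Qed.

Definition flow_le : rel (gv D) := fun x y => (vid x, vid y) \in pairs L.
Definition flow_f (i : 'I_n) : gv D := s2val (vidx_pick (fval_vs i)).
Definition flow_sets : {set {set gv D}} :=
  [set C | has (fun s => C == toset D s) (csets l L)].

Lemma vidx_flow_f i : vid (flow_f i) = fval l L i.
Proof. exact: (s2valP' (vidx_pick (fval_vs i))). Qed.

Lemma mem_flow_sets C :
  C \in flow_sets <-> exists2 s, s \in csets l L & C = [set x in VG D | vid x \in s].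
Proof.
rewrite inE; split=> [/hasP[s sc /eqP ->]|[s sc ->]]; first by exists s.
by apply/hasP; exists s.
Qed.

Hypothesis all_added : all (fun v => v \in L) (vs l).

Lemma mem_greedy x : (vid x \in L) = (x \in VG D).
Proof.
rewrite -mem_vs_vidx; apply/idP/idP; first exact: greedy_sub.
by move/(allP all_added).
Qed.

Lemma flow_leE x y : flow_le x y =
  [&& x \in VG D, y \in VG D & index (vid x) L <= index (vid y) L].
Proof. by rewrite /flow_le mem_pairs ?greedy_uniq // !mem_greedy. Qed.

Lemma flow_ltE x y : x \in VG D -> lt D flow_le x y = (vid y \in after L (vid x)).
Proof.
move=> xV; rewrite /lt flow_leE xV mem_after ?greedy_uniq // mem_greedy /= -andbA.
case yV : (y \in VG D) => //=.
rewrite ltn_neqAle andbC; congr (_ && _).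
case: (eqVneq x y) => [->|xy]; first by rewrite eqxx.
apply/esym/eqP => E; case/eqP: xy; apply: (@vidx_inj D).
have [x1 y1] : vid x \in L /\ vid y \in L by rewrite !mem_greedy.
by rewrite -(nth_index 0 x1) E nth_index.
Qed.

Lemma flow_po : partial_order_on D flow_le.
Proof.
split=> [x y|x xV|x y|x y z]; rewrite ?flow_leE.
- by case/and3P.
- by rewrite xV leqnn.
- move=> /and3P[xV yV xy] /and3P[_ _ yx]; apply: (@vidx_inj D).
  have E : index (vid x) L = index (vid y) L by apply/eqP; rewrite eqn_leq xy yx.
  have [x1 y1] : vid x \in L /\ vid y \in L by rewrite !mem_greedy.
  by rewrite -(nth_index 0 x1) E nth_index.
- move=> /and3P[xV yV xy] /and3P[_ zV yz].
  by rewrite xV zV (leq_trans xy yz).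
Qed.

Lemma flow_corrector i u : u \in VG D -> ~~ nilp (solve l (after L (vid (inl i))) (vid u)) ->
  exists2 C, C \in flow_sets & corrector D flow_le C (inl i) u.
Proof.
move=> uV; case E : (solve _ _ _) => [|C t] // _.
have CS : C \in solve l (after L (vid (inl i))) (vid u) by rewrite E mem_head.
exists (toset D C).
  rewrite inE; apply/hasP; exists C => //.
  apply/flattenP; exists (flatten [seq take 1 (solve l (after L i) k) | k <- vs l]).
    by apply/mapP; exists (nat_of_ord i); rewrite // mem_iota add0n nn_code leq0n ltn_ord.
  apply/flattenP; exists (take 1 (solve l (after L i) (vid u))).
    by apply/mapP; exists (vid u); rewrite // mem_vs_vidx.
  by rewrite E /= mem_head.
have [uO HC] := solve_corrects uV CS.
by split=> // w /HC; rewrite flow_ltE // inE.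
Qed.

Lemma flow_correct : PFflow D flow_le flow_f flow_sets.
Proof.
split; [exact: flow_po | | |].
- by move=> i _; rewrite -mem_greedy vidx_flow_f; apply: (allP all_added); apply: fval_vs.
- move=> C; rewrite inE => /hasP[s _ /eqP ->].
  by apply/subsetP => x; rewrite inE => /andP[].
move=> i _ v.
have vV : v \in VG D by rewrite inE.
have vi : vid v = i by [].
have vL : nat_of_ord i \in L by rewrite -vi mem_greedy.
have := greedy_addable vL; rewrite /addable nn_code ltn_ord => /and3P[/allP Hout Hself Hbad].
split.
- move=> u uV au; rewrite !flow_leE uV vV /=.
  have ul : vid u \in vs l by rewrite mem_vs_vidx.
  have [[k uk]|uO|uI] := VG_cases uV.
  + have -> : u \notin Oset D by rewrite uk inE.
    have -> : u \notin Iset D by rewrite uk inE.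
    by rewrite !andbT leq_total.
  + have := Hout _ ul; rewrite isout_vidx uO -vi adj_vidx au /= negbK.
    rewrite mem_after ?greedy_uniq // => /andP[_ /ltnW ->].
    by rewrite (Oset_Iset uO) orbT.
  have uO : u \notin Oset D by apply: contraL uI => /Oset_Iset.
  have uL : vid u \in L by rewrite mem_greedy.
  (* For an input, condition (i) follows from the test on the input: it was added after its
     neighbour [v], hence lies below it. *)
  have := greedy_addable uL; rewrite /addable nn_code isout_vidx (negbTE uO) /=.
  have -> : (vid u < n) = false by move: uI; rewrite inE; case: (u) => // -[k b] _ /=; lia.
  move=> /allP /(_ (vid v)); rewrite mem_vs_vidx adj_vidx sadj_sym au /= ltn_ord negbK.
  move=> /(_ vV); rewrite mem_after ?greedy_uniq // => /andP[_ /ltnW h].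
  by rewrite h.
- move=> N0; apply: flow_corrector => //; case/orP: Hself => // /hasP[k /vs_vidx[u uV <-]].
  rewrite -vi adj_vidx -flow_ltE // => /andP[lu au].
  suff : u \in Nplus D flow_le v by rewrite (cards0_eq N0) inE.
  by rewrite inE uV au lu.
move=> u; rewrite inE => /and3P[uV au luv] uf; apply: flow_corrector => //.
apply: contra uf => su; rewrite -(inj_eq (@vidx_inj D)) vidx_flow_f /fval.
(* Without a corrector, [u] would be bad; the list has at most one entry and [f] takes its head, so
   [u] would equal [f i]. *)
have : vid u \in bad l (after L i) i.
  rewrite mem_filter mem_vs_vidx uV andbT -vi adj_vidx au (inj_eq (@vidx_inj D)).
  rewrite [nilp _]su !andbT -flow_ltE //; apply/andP; split; last by case/andP: luv.
  apply/negP => lvu; case/andP: luv => luv nuv; case/andP: lvu => lvu _.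
  by case: flow_po => _ _ anti _; rewrite (anti _ _ luv lvu) eqxx in nuv.
by case: (bad _ _ _) Hbad => [|a [|b t]] //= _; rewrite inE.
Qed.

Lemma flow_encoded : encodes_PFflow D (enc_nats (answer l L)).
Proof.
exists flow_le, flow_f, flow_sets; split; first exact: flow_correct.
exists (pairs L), (csets l L); split; last by split=> [//|C]; apply: mem_flow_sets.
rewrite /answer all_added; congr (enc_nats (_ :: _ :: _ ++ (_ ++ _))).
rewrite nn_code -val_enum_ord -map_comp; apply: eq_map => i /=.
by rewrite vidx_flow_f.
Qed.

End Correct.

Lemma answer_correct D : graph_like D ->
  (enc_nats (answer (code_zx D) (greedy (code_zx D))) = enc_nats [:: 0] /\ ~ has_PFflow D) \/
  encodes_PFflow D (enc_nats (answer (code_zx D) (greedy (code_zx D)))).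
Proof.
move=> gl; case: (boolP (all (fun v => v \in greedy (code_zx D)) (vs (code_zx D)))) => al.
  by right; apply: flow_encoded.
left; split; last by move=> /(greedy_complete gl); rewrite (negbTE al).
by rewrite /answer (negbTE al).
Qed.

(** * Size of the input *)

Section Size.
Variable D : zx.
Hypothesis gl : graph_like D.
Notation n := (nnodes D).
Notation m := (nwires D).

Lemma nnodes_le : n <= zx_size D.
Proof.
rewrite /zx_size -addnA; apply: leq_trans (leq_addr _ _).
by rewrite -{1}(card_ord n) -cardsT subset_leq_card //; apply/subsetP => i _; apply: spider.
Qed.

Lemma open_wires_le :
  #|[set k : 'I_m | is_open (wend D k false) || is_open (wend D k true)]| <= zx_size D.
Proof.
(* Each such wire is sent to one of its open ends, the first one if it is open. *)
set A := [set k | _]; pose g (k : 'I_m) : gv D := inr (k, ~~ is_open (wend D k false)).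
have gi : injective g by move=> k k' [].
rewrite -(card_imset A gi); apply: (@leq_trans #|Iset D :|: Oset D|); last first.
  by apply: leq_trans (leq_card_setU _ _) _; rewrite /zx_size -addnA leq_addl.
apply/subset_leq_card/subsetP => x /imsetP[k]; rewrite inE => kA ->.
rewrite !inE /g; move: kA; case E : (is_open (wend D k false)) => /=.
  by move: E; rewrite /wend /=; case: (_.1).
by case: (_.2).
Qed.

(** Without parallel wires, a wire between two nodes is determined by the pair of its ends. The
    extra one counts the value [None] of the injection, which is not taken on these wires. *)
Lemma closed_wires_le :
  #|[set k : 'I_m | ~~ (is_open (wend D k false) || is_open (wend D k true))]| <= (n * n).+1.
Proof.
set A := [set k | _]; pose g (k : 'I_m) : option ('I_n * 'I_n) :=
  match wend D k false, wend D k true with ESp i, ESp j => Some (i, j) | _, _ => None end.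
have gi : {in A &, injective g}.
  move=> k k'; rewrite !inE negb_or /g.
  case: gl => _ _ _ /(_ k k').
  case E1 : (wend D k false) => [i||] //; case E2 : (wend D k true) => [j||] // par _ _.
  case E3 : (wend D k' false) => [i'||] //; case E4 : (wend D k' true) => [j'||] // [ii jj].
  have [//|ne] := eqVneq k k'; exfalso; apply: (par i j); first exact/eqP.
    by rewrite /= !eqxx.
  by rewrite E3 E4 /= -ii -jj !eqxx.
rewrite -(card_in_imset gi); apply: leq_trans (max_card _) _.
by rewrite card_option card_prod card_ord.
Qed.

Lemma nwires_le : m <= zx_size D + (n * n).+1.
Proof.
have <- := card_ord m.
rewrite -(cardsC [set k : 'I_m | is_open (wend D k false) || is_open (wend D k true)]).
apply: leq_add open_wires_le _; apply: leq_trans closed_wires_le.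
by apply/subset_leq_card/subsetP => k; rewrite !inE.
Qed.

Lemma size_enc_nats (N : nat) (s : seq nat) : all (fun i => i <= N) s ->
  size (enc_nats s) <= size s * N.+1.
Proof.
elim: s => //= a s IH /andP[aN /IH h]; rewrite size_cat /enc_nat size_cat size_nseq mulSn.
by rewrite addn1; apply: leq_add.
Qed.

Lemma code_ep_le (e : endpoint n) : code_ep e <= n + 1.
Proof. by case: e => [i||] /=; [have := ltn_ord i | |]; lia. Qed.

(** There are [3n + 2m + 2] entries, each at most [n + m + 2], and the unary code of an entry has
    one closing bit. *)
Lemma size_input_word : size (input_word D) <= (n + n + n + m + m + 2) * (n + m + 3).
Proof.
have H : all (fun i => i <= n + m + 2) (code_zx D).
  rewrite code_zxE /= all_cat /=; apply/and4P; split; [lia | | lia |].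
    apply/allP => x /flatten_mapP[i _]; rewrite !inE => /or3P[] /eqP ->.
    - by case: (kind D i) => /=; lia.
    - by case: (phase_in_P _) => /=; lia.
    - by case: (phase_odd _) => /=; lia.
  elim: (wires D) => //= w s ->; rewrite andbT.
  by have := code_ep_le w.1; have := code_ep_le w.2; lia.
apply: leq_trans (size_enc_nats H) _; rewrite addn3 addn2 leq_mul2r; apply/orP; right.
rewrite code_zxE /= size_cat size_block3 size_enum_ord /=.
have -> : size (flatten [seq [:: code_ep w.1; code_ep w.2] | w <- wires D]) = m + m.
  by rewrite /nwires; elim: (wires D) => //= w s ->; lia.
lia.
Qed.

End Size.

Theorem theorem2 :
  exists (M : TM) (c k : nat),
    forall D : zx, graph_like D ->
      exists out : seq bool,
        halts_within M (input_word D) (c * (zx_size D).+1 ^ k) out /\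
        ((out = enc_nats [:: 0] /\ ~ has_PFflow D) \/ encodes_PFflow D out).
Proof.
have [M [c [k HM]]] := pfflow_alg_halts.
(* The machine's running time is polynomial in the length of its input word. For a diagram of size
   [z], [mb z] bounds the number of wires and [sb z] that length, which turns it into a bound in
   [z]. *)
pose mb z := z + (z * z).+1.
pose sb z := (z + z + z + mb z + mb z + 2) * (z + mb z + 3).
have [c' [k' Hb]] : pb (fun z => c * (sb z).+1 ^ k) by rewrite /sb /mb; pbs.
exists M, c', k' => D gl; exists (enc_nats (answer (code_zx D) (greedy (code_zx D)))).
split; last exact: answer_correct.
have [t [tk Ht]] := HM (code_zx D); exists t; split=> //.
apply: leq_trans tk (leq_trans _ (Hb _)); apply: leq_cexp.
have nz := nnodes_le gl; have mz : nwires D <= mb (zx_size D).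
  by apply: leq_trans (nwires_le gl) _; rewrite leq_add2l ltnS leq_mul.
by apply: leq_trans (size_input_word D) _; apply: leq_mul; lia.
Qed.
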